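(* Let $\alpha\in(0,2)$, and for $n\in\mathbb Z$ let $\lambda_n(x)=\left(\dfrac{ix-1}{ix+1}\right)^n$, $x\in\mathbb R$. Then, for every $x\in\mathbb R$, $$ (-\Delta)^{\alpha/2}\lambda_n(x)= \begin{cases} 0, & n=0,\\[0.5em] -\dfrac{2|n|\,\Gamma(1+\alpha)}{(i\,\mathrm{sgn}(n)x+1)^{1+\alpha}}\;{}_2F_1\!\left(1-|n|,1+\alpha;2;\dfrac{2}{i\,\mathrm{sgn}(n)x+1}\right), & n\in\mathbb Z\setminus\{0\}. \end{cases} $$
   Context: For $\alpha\in(0,2)$ the one-dimensional fractional Laplacian of a (possibly complex-valued) function $u$ on $\mathbb R$ is $$(-\Delta)^{\alpha/2}u(x)=c_\alpha\int_{-\infty}^\infty\frac{u(x)-u(x+y)}{|y|^{1+\alpha}}\,dy,\qquad c_\alpha=\alpha\,\frac{2^{\alpha-1}\Gamma(1/2+\alpha/2)}{\sqrt\pi\,\Gamma(1-\alpha/2)},$$ the integral being understood in the principal value sense at $y=0$; equivalently, for the functions considered here, $(-\Delta)^{\alpha/2}u(x)=\frac{c_\alpha}{\alpha}\int_0^\infty\frac{u'(x-y)-u'(x+y)}{y^\alpha}\,dy$. Complex powers are taken with the principal branch of the logarithm ($-\pi<\arg\le\pi$). $\mathrm{sgn}(n)=1$ for $n>0$ and $-1$ for $n<0$. The Gaussian hypergeometric function is ${}_2F_1(a,b;c;z)=\sum_{k=0}^\infty\frac{(a)_k(b)_k}{(c)_k}\frac{z^k}{k!}$, where $(w)_0=1$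 and $(w)_k=w(w+1)\cdots(w+k-1)$ for $k\ge1$. When $a$ is a nonpositive integer the sum is finite (terms with $k>-a$ vanish), and it is then defined by this finite sum for all $z\in\mathbb C$. *)

(* Defs.v *)
From HB Require Import structures.
From mathcomp Require Import all_boot all_order all_algebra.
From mathcomp Require Import all_classical all_reals all_analysis.
From mathcomp Require Import complex.
Set Implicit Arguments.
Unset Strict Implicit.
Unset Printing Implicit Defensive.
Import Order.TTheory GRing.Theory Num.Theory.
Import numFieldNormedType.Exports.
Local Open Scope classical_set_scope.
Local Open Scope ring_scope.
Local Open Scope complex_scope.

Section ComplexAnalysis.
Context {R : realType}.
Implicit Types (z w : R[i]) (D : set R) (f : R -> R[i]).

(* Convergence in C is taken componentwise, which is the same as convergence
   for the modulus. *)
Definition ccvg (T : Type) (F : set_system T) (g : T -> R[i]) : Prop :=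
  cvg (complex.Re (g t) @[t --> F]) /\ cvg (complex.Im (g t) @[t --> F]).

Definition clim (T : Type) (F : set_system T) (g : T -> R[i]) : R[i] :=
  lim (complex.Re (g t) @[t --> F]) +i* lim (complex.Im (g t) @[t --> F]).

Definition cintegrable D f : Prop :=
  lebesgue_measure.-integrable D (EFin \o (fun y => complex.Re (f y))) /\
  lebesgue_measure.-integrable D (EFin \o (fun y => complex.Im (f y))).

Definition cintegral D f : R[i] :=
  (\int[lebesgue_measure]_(y in D) complex.Re (f y)) +i*
  (\int[lebesgue_measure]_(y in D) complex.Im (f y)).

(* Principal value at 0 of the integral of f over the real line: the limit, as
   eps tends to 0 from the right, of the integrals over |y| > eps. *)
Definition pv_integrable f : Prop :=
  (forall eps : R, 0 < eps -> cintegrable [set y | eps < `|y|] f) /\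
  ccvg 0^'+ (fun eps : R => cintegral [set y | eps < `|y|] f).

Definition pv_integral f : R[i] :=
  clim 0^'+ (fun eps : R => cintegral [set y | eps < `|y|] f).

Definition cexp z : R[i] :=
  (expR (complex.Re z))%:C * (cos (complex.Im z) +i* sin (complex.Im z)).

(* The argument in ]-pi, pi]; its value at 0 is irrelevant. *)
Definition carg z : R :=
  if 0 <= complex.Im z then acos (complex.Re z / Normc.normc z)
  else - acos (complex.Re z / Normc.normc z).

Definition clog z : R[i] := ln (Normc.normc z) +i* carg z.

(* Meaningful for z != 0 only. *)
Definition cpow z w : R[i] := cexp (w * clog z).

End ComplexAnalysis.

Section SpecialFunctions.
Context {R : realType}.

(* Euler's integral, which is the Gamma function for s > 0. *)
Definition Gamma (s : R) : R :=
  \int[lebesgue_measure]_(t in `]0, +oo[) (t `^ (s - 1) * expR (- t)).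

Definition pochhammer (w : R[i]) (k : nat) : R[i] := \prod_(j < k) (w + j%:R).

Definition hyp2F1_term (a b c z : R[i]) (k : nat) : R[i] :=
  pochhammer a k * pochhammer b k / pochhammer c k * (z ^+ k / k`!%:R).

(* If a is a nonpositive integer the partial sums are eventually constant, so
   this is the finite sum for every z: see hyp2F1_finite. *)
Definition hyp2F1 (a b c z : R[i]) : R[i] :=
  clim \oo (fun n : nat => \sum_(k < n) hyp2F1_term a b c z k).

Lemma hyp2F1_finite (m : nat) (b c z : R[i]) :
  hyp2F1 (- m%:R) b c z = \sum_(k < m.+1) hyp2F1_term (- m%:R) b c z k.
Proof.
have stat n : (m < n)%N ->
    \sum_(k < n) hyp2F1_term (- m%:R) b c z k =
    \sum_(k < m.+1) hyp2F1_term (- m%:R) b c z k.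
  move=> mn; rewrite -(subnKC mn) big_split_ord /= [X in _ + X]big1 ?addr0//.
  move=> i _; rewrite /hyp2F1_term /pochhammer.
  have mi : (m < m.+1 + i)%N by rewrite addSn ltnS leq_addr.
  by rewrite (bigD1 (Ordinal mi))//= addNr !mul0r.
have ev : \forall n \near \oo, (m < n)%N by exact: nbhs_infty_gt.
rewrite /hyp2F1 /clim.
set S := (X in _ = X); rewrite [RHS](_ : S = complex.Re S +i* complex.Im S); last by case: S.
by congr (_ +i* _); apply: lim_near_cst => //; near=> n; rewrite stat//; near: n.
Unshelve. all: by end_near.
Qed.

End SpecialFunctions.

Section FractionalLaplacian.
Context {R : realType}.

Definition frac_laplacian_const (alpha : R) : R :=
  alpha * (2 `^ (alpha - 1) * Gamma (1 / 2 + alpha / 2) /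
           (Num.sqrt pi * Gamma (1 - alpha / 2))).

Definition frac_laplacian_integrand (alpha : R) (u : R -> R[i]) (x y : R) : R[i] :=
  (u x - u (x + y)) / (`|y| `^ (1 + alpha))%:C.

(* The principal value defining the fractional Laplacian of u at x exists. *)
Definition frac_laplacian_defined (alpha : R) (u : R -> R[i]) (x : R) : Prop :=
  pv_integrable (frac_laplacian_integrand alpha u x).

Definition frac_laplacian (alpha : R) (u : R -> R[i]) (x : R) : R[i] :=
  (frac_laplacian_const alpha)%:C *
  pv_integral (frac_laplacian_integrand alpha u x).

Definition lambda (n : int) (x : R) : R[i] :=
  (('i%C * x%:C - 1) / ('i%C * x%:C + 1)) ^ n.

End FractionalLaplacian.

(* Main.v *)
(* With s = sgn n and N = |n|, expanding lambda_n = (1 - 2 / (1 + isx))^N and using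
   (1 + isx)^-k = Gamma(k)^-1 int_0^oo t^(k-1) exp(-t (1 + isx)) dt gives
   lambda_n(x) = 1 + int_0^oo m(t) exp(-istx) dt, where m is exp(-t) times a polynomial.
   By Fubini the fractional Laplacian multiplies exp(-istx) by t^alpha, because
   int_0^oo 2 (1 - cos(ty)) y^(-1-alpha) dy = t^alpha / c_alpha; the same Gamma integral,
   now with exponents k + alpha, then yields the terms of the hypergeometric sum.
   The constant c_alpha comes from integrating the last identity against exp(-t^2): only the
   Fourier transform of the Gaussian is needed, and no reflection or duplication formula. *)
Require Import Defs.
From HB Require Import structures.
From mathcomp Require Import all_boot all_order all_algebra.
From mathcomp Require Import all_classical all_reals all_analysis measurable_realfun.
From mathcomp Require Import complex.
From mathcomp Require Import ring lra.
Set Implicit Arguments.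
Unset Strict Implicit.
Unset Printing Implicit Defensive.
Import Order.TTheory GRing.Theory Num.Theory.
Import numFieldNormedType.Exports.
Local Open Scope classical_set_scope.
Local Open Scope ring_scope.
Local Open Scope complex_scope.

(** A principal value does not lend itself to Fubini, so it is removed beforehand: folding y < 0
    onto y > 0 turns the integral over |y| > eps into one of (2 u(x) - u(x+y) - u(x-y)) y^(-1-alpha)
    over y > eps. This is absolutely integrable down to 0, and the limit in eps is dominated
    convergence. On a Fourier integral the second difference produces the nonnegative factor 2 (1 -
    cos(ty)), so the absolute double integral is computed exactly rather than estimated. All
    integration is real. Real and imaginary parts are integrals against a bounded kernel T with
    T(a+b) + T(a-b) = 2 T(a) cos b, a law shared by cos(sz) and -sin(sz) for s = 1 or -1, so one
    lemma serves both. The complex Gamma integral is obtained from a linear differential system in v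
    and compared with (1 + iv)^p in polar form, which settles the branch. Existence and value of the
    fractional Laplacian are proved together, because [pv_integral] denotes some number even where
    the limit fails to exist. *)

Section ImproperIntegrals.
Context {R : realType}.
Notation mu := (@lebesgue_measure R).
Implicit Types f F G : R -> R.

(** * Improper integrals over the open half line, by compact exhaustion *)

Definition itv_inv (n : nat) : set R := `[n.+1%:R^-1, n.+1%:R]%classic.

Lemma itv_invE n x : itv_inv n x = (n.+1%:R^-1 <= x <= n.+1%:R).
Proof. by rewrite /itv_inv/= in_itv. Qed.

Lemma measurable_itv_inv n : measurable (itv_inv n).
Proof. exact: measurable_itv. Qed.

Lemma bigcup_itv_inv : \bigcup_n itv_inv n = `]0, +oo[%classic.
Proof.
apply/seteqP; split => x /=.
  move=> [n _]; rewrite itv_invE => /andP[nx _]; rewrite in_itv/= andbT.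
  by apply: lt_le_trans nx; rewrite invr_gt0.
rewrite in_itv/= andbT => x0.
have [n nx] : exists n : nat, x + x^-1 < n%:R.
  by exists (Num.truncn (x + x^-1)).+1; exact: truncnS_gt.
exists n => //; rewrite itv_invE; apply/andP; split.
  rewrite -[leRHS]invrK lef_pV2 ?posrE ?invr_gt0 ?ltr0Sn//.
  by rewrite (le_trans (ltW (lt_trans _ nx)) _) ?ltrDr// ler_nat.
by rewrite (le_trans (ltW (lt_trans _ nx)) _) ?ltrDl ?invr_gt0// ler_nat.
Qed.

Lemma itv_inv_sub n : itv_inv n `<=` `]0, +oo[.
Proof. by rewrite -bigcup_itv_inv; exact: bigcup_sup. Qed.

Lemma nondecreasing_itv_inv : nondecreasing_seq itv_inv.
Proof.
move=> m n mn; apply/subsetPset => x; rewrite !itv_invE => /andP[mx xm].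
apply/andP; split; last by rewrite (le_trans xm)// ler_nat.
by apply: le_trans mx; rewrite lef_pV2 ?posrE// ler_nat.
Qed.

Lemma continuous_measurable_gt0 f : (forall x : R, 0 < x -> {for x, continuous f}) ->
  measurable_fun (`]0, +oo[%classic : set R) f.
Proof.
move=> cf; apply: open_continuous_measurable_fun; first exact: interval_open.
by move=> x; rewrite inE/= in_itv/= andbT; exact: cf.
Qed.

Lemma continuous_within_gt0 f a b : 0 < a -> (forall x : R, 0 < x -> {for x, continuous f}) ->
  {within `[a, b], continuous f}.
Proof.
move=> a0 cf; apply: continuous_in_subspaceT => x; rewrite inE/= in_itv/= => /andP[ax _].
by apply: cf; exact: lt_le_trans ax.
Qed.

(** Dominated convergence with majorant |f|. Eventual membership is asked instead of monotonicity of
    [E], because in [pv_second_difference] the cut-offs run along an arbitrary sequence tending to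
    0. *)
Lemma cvg_Rintegral_exhaustion (D : set R) (E : (set R)^nat) f :
  measurable D -> mu.-integrable D (EFin \o f) ->
  (forall n, measurable (E n)) -> (forall n, E n `<=` D) ->
  (forall x, D x -> \forall n \near \oo, E n x) ->
  (\int[mu]_(x in E n) f x) @[n --> \oo] --> \int[mu]_(x in D) f x.
Proof.
move=> mD If mE ED DE.
have mf : measurable_fun D (EFin \o f : R -> \bar R).
  exact: measurable_int If.
have [| | | | |_ _ cv] := @dominated_convergence _ _ _ mu D mD
  (fun n => (EFin \o f) \_ (E n)) (EFin \o f) (abse \o (EFin \o f)).
- move=> n; apply/(measurable_restrict _ (mE n) mD).
  by apply: measurable_funS mf => //; exact: subIsetl.
- by [].
- apply: aeW => x Dx; apply: cvg_near_cst.
  by apply: filterS (DE _ Dx) => n Enx; rewrite patchE mem_set.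
- exact: integrable_abse.
- apply: aeW => x n Dx; rewrite patchE; case: ifP => //=.
  by rewrite normr0 lee_fin.
rewrite /Rintegral; apply: fine_cvg; rewrite fineK; last exact: integrable_fin_num.
apply: cvg_trans cv; apply: near_eq_cvg; apply: nearW => n.
by rewrite [RHS]integral_mkcond [LHS]integral_mkcond -patch_setI (setIidr (@ED n)).
Qed.

Lemma ge0_cvg_integral_itv_inv f : (forall x : R, 0 < x -> 0 <= f x) ->
  measurable_fun (`]0, +oo[%classic : set R) f ->
  (\int[mu]_(x in itv_inv n) (f x)%:E)%E @[n --> \oo] -->
  (\int[mu]_(x in `]0%R, +oo[) (f x)%:E)%E.
Proof.
move=> f0 mf; rewrite -bigcup_itv_inv; apply: ge0_nondecreasing_set_cvg_integral.
- exact: nondecreasing_itv_inv.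
- exact: measurable_itv_inv.
- move=> n; apply/measurable_EFinP; apply: measurable_funS mf => //.
  exact: itv_inv_sub.
- move=> n x; rewrite itv_invE => /andP[nx _]; rewrite lee_fin f0//.
  by apply: lt_le_trans nx; rewrite invr_gt0.
Qed.

Lemma integral_itv_inv f F (n : nat) : (forall x : R, 0 < x -> {for x, continuous f}) ->
  (forall x : R, 0 < x -> is_derive x (1 : R) F (f x)) ->
  (\int[mu]_(x in itv_inv n) (f x)%:E = (F n.+1%:R - F n.+1%:R^-1)%:E)%E.
Proof.
(* For n = 0 the interval is the single point 1 and both sides vanish; the fundamental theorem is
   applied to the nondegenerate intervals. *)
move=> cf dF; case: n => [|n]; first by rewrite /itv_inv invr1 set_itv1 integral_set1 subrr.
have n0 : 0 < n.+2%:R^-1 :> R by rewrite invr_gt0.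
have cF x : 0 < x -> {for x, continuous F}.
  by move=> /dF[dFx _]; apply: differentiable_continuous; exact/derivable1_diffP.
rewrite (@continuous_FTC2 _ f F) ?EFinB//.
- by rewrite (@lt_trans _ _ 1)// ?invf_lt1// ltr1n.
- exact: continuous_within_gt0.
- split => [x| |].
  + by rewrite in_itv/= => /andP[nx _]; have [] := dF x (lt_trans n0 nx).
  + by apply: cvg_at_right_filter; exact: cF.
  + by apply: cvg_at_left_filter; exact: cF.
- move=> x; rewrite in_itv/= => /andP[nx _]; rewrite derive1E.
  by have [] := dF x (lt_trans n0 nx).
Qed.

Lemma cvg_itv_inv F (l l0 : R) :
  F x @[x --> +oo%R] --> l -> F x @[x --> 0^'+] --> l0 ->
  (F n.+1%:R - F n.+1%:R^-1) @[n --> \oo] --> l - l0.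
Proof.
move=> Fy F0; apply: cvgB.
- by move/cvg_pinftyP: Fy; apply; apply/cvgryPge => r; near=> n;
    rewrite (le_trans _ (_ : n%:R <= _)) ?ler_nat//; near: n; exact: nbhs_infty_ger.
- move/cvg_at_rightP: F0; apply; split; first by move=> n; rewrite invr_gt0.
  exact: cvg_harmonic.
Unshelve. all: by end_near. Qed.

(** Monotone convergence along [itv_inv]: [f] may blow up at 0, and the finite right-hand side also
    yields integrability. *)
Lemma ge0_FTC2_gt0 f F (l l0 : R) : (forall x : R, 0 < x -> 0 <= f x) ->
  (forall x : R, 0 < x -> {for x, continuous f}) ->
  (forall x : R, 0 < x -> is_derive x (1 : R) F (f x)) ->
  F x @[x --> +oo%R] --> l -> F x @[x --> 0^'+] --> l0 ->
  (\int[mu]_(x in `]0%R, +oo[) (f x)%:E = (l - l0)%:E)%E.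
Proof.
move=> f0 cf dF Fy F0.
have c1 := ge0_cvg_integral_itv_inv f0 (continuous_measurable_gt0 cf).
apply: (cvg_unique _ c1) => //=.
under eq_cvg do rewrite (integral_itv_inv _ cf dF).
by apply: cvg_EFin; [exact: nearW|exact: cvg_itv_inv].
Qed.

Lemma Rintegral_FTC2_gt0 f F (l l0 : R) :
  mu.-integrable `]0, +oo[ (EFin \o f) ->
  (forall x : R, 0 < x -> {for x, continuous f}) ->
  (forall x : R, 0 < x -> is_derive x (1 : R) F (f x)) ->
  F x @[x --> +oo%R] --> l -> F x @[x --> 0^'+] --> l0 ->
  \int[mu]_(x in `]0, +oo[) f x = l - l0.
Proof.
move=> If cf dF Fy F0.
have c1 : (\int[mu]_(x in itv_inv n) f x) @[n --> \oo] -->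
    \int[mu]_(x in `]0, +oo[) f x.
  apply: cvg_Rintegral_exhaustion => //.
  - exact: measurable_itv_inv.
  - exact: itv_inv_sub.
  - move=> x; rewrite -bigcup_itv_inv => -[n _ nx]; exists n => // m /= nm.
    by have /subsetPset := nondecreasing_itv_inv nm; apply.
apply: (cvg_unique _ c1) => //=.
under eq_cvg do rewrite /Rintegral (integral_itv_inv _ cf dF)/=.
exact: cvg_itv_inv.
Qed.

(** The substitution is made on each compact [itv_inv n], whose image is [F(1/(n+1)), F(n+1)]; both
    sides then pass to the half line by monotone convergence. *)
Lemma ge0_integration_by_substitution_gt0 F F' G :
  (forall x : R, 0 < x -> 0 < F x) -> (forall x : R, 0 < x -> 0 <= F' x) ->
  (forall x y : R, 0 < x -> x < y -> F x < F y) ->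
  (forall x : R, 0 < x -> is_derive x (1 : R) F (F' x)) ->
  (forall x : R, 0 < x -> {for x, continuous F'}) ->
  F x @[x --> 0^'+] --> (0 : R) -> F x @[x --> +oo%R] --> +oo%R ->
  (forall x : R, 0 < x -> {for x, continuous G}) -> (forall x : R, 0 < x -> 0 <= G x) ->
  (\int[mu]_(x in `]0%R, +oo[) (G x)%:E =
   \int[mu]_(x in `]0%R, +oo[) (G (F x) * F' x)%:E)%E.
Proof.
move=> F0 F'0 incF dF cF' Fto0 Ftoy cG G0.
have cF x : 0 < x -> {for x, continuous F}.
  by move=> /dF[dFx _]; apply: differentiable_continuous; exact/derivable1_diffP.
have cGF x : 0 < x -> {for x, continuous (fun x => G (F x) * F' x)}.
  move=> x0; apply: continuousM; last exact: cF'.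
  by apply: continuous_comp; [exact: cF|apply: cG; exact: F0].
have GF0 x : 0 < x -> 0 <= G (F x) * F' x.
  by move=> x0; rewrite mulr_ge0 ?G0 ?F0 ?F'0.
have cv := ge0_cvg_integral_itv_inv GF0 (continuous_measurable_gt0 cGF).
apply: (cvg_unique _ _ cv) => //.
pose E n : set R := `[F n.+1%:R^-1, F n.+1%:R]%classic.
have leF x y : 0 < x -> x <= y -> F x <= F y.
  by move=> x0; rewrite le_eqVlt => /predU1P[->//|xy]; exact/ltW/incF.
(* The limits of [F] at 0 and at infinity are what makes the image intervals fill the half line. *)
have EP : `]0, +oo[%classic = \bigcup_n E n.
  apply/seteqP; split => x /=; last first.
    move=> [n _]; rewrite /E /= !in_itv/= andbT => /andP[nx _].
    by apply: lt_le_trans nx; apply: F0; rewrite invr_gt0.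
  rewrite in_itv/= andbT => x0.
  have [A] : \forall n \near \oo, F n.+1%:R^-1 <= x.
    have : F n.+1%:R^-1 @[n --> \oo] --> 0.
      move/cvg_at_rightP: Fto0; apply; split; first by move=> n; rewrite invr_gt0.
      exact: cvg_harmonic.
    by move/cvgr_le; apply.
  have [B] : \forall n \near \oo, x <= F n.+1%:R.
    have : F n.+1%:R @[n --> \oo] --> +oo.
      apply: cvg_comp Ftoy; apply/cvgryPge => r; near=> n.
      by rewrite (le_trans _ (_ : n%:R <= _)) ?ler_nat//; near: n; exact: nbhs_infty_ger.
    by move/cvgryPge; apply.
  move=> _ Bx _ Ax; exists (maxn A B) => //=; rewrite /E/= in_itv/=.
  by rewrite Ax ?Bx//= ?leq_maxl ?leq_maxr.
have F'E (x : R) : 0 < x -> F^`()%classic x = F' x.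
  by move=> x0; rewrite derive1E; have [_] := dF x x0.
have cdF (x : R) : 0 < x -> F^`()%classic y @[y --> x] --> F' x.
  move=> x0; apply: cvg_trans (cF' x x0); apply: near_eq_cvg; near=> y.
  by rewrite F'E//; near: y; exact: lt_nbhsr.
have Int n : (\int[mu]_(x in itv_inv n) (G (F x) * F' x)%:E =
    \int[mu]_(x in E n) (G x)%:E)%E.
  have n0 : 0 < n.+1%:R^-1 :> R by rewrite invr_gt0.
  rewrite /E (@integration_by_substitution_increasing _ F G).
  - apply: eq_integral => x; rewrite inE itv_invE => /andP[nx _].
    by rewrite !fctE F'E// (lt_le_trans n0 nx).
  - by rewrite (@le_trans _ _ 1)// ?invf_le1// ler1n.
  - by move=> x y; rewrite !in_itv/= => /andP[nx _] _; apply: incF; exact: lt_le_trans nx.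
  - move=> x; rewrite in_itv/= => /andP[nx _]; have x0 := lt_trans n0 nx.
    by rewrite /prop_for /continuous_at F'E//; exact: cdF.
  - by apply/cvg_ex; exists (F' n.+1%:R^-1); apply: cvg_at_right_filter; exact: cdF.
  - by apply/cvg_ex; exists (F' n.+1%:R); apply: cvg_at_left_filter; exact: cdF.
  - split.
    + by move=> x; rewrite in_itv/= => /andP[nx _]; have [] := dF x (lt_trans n0 nx).
    + by apply: cvg_at_right_filter; exact: cF.
    + by apply: cvg_at_left_filter; exact: cF.
  - by apply: continuous_within_gt0 => //; exact: F0.
rewrite EP /=; under eq_cvg do rewrite Int.
apply: ge0_nondecreasing_set_cvg_integral.
- move=> m n mn; apply/subsetPset => x; rewrite /E/= !in_itv/= => /andP[mx xm].
  apply/andP; split; last by rewrite (le_trans xm)// leF// ler_nat.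
  by apply: le_trans mx; rewrite leF ?invr_gt0// lef_pV2 ?posrE// ler_nat.
- by move=> n; exact: measurable_itv.
- move=> n; apply/measurable_EFinP; apply: measurable_funS (continuous_measurable_gt0 cG) => //.
  by rewrite EP; exact: bigcup_sup.
- move=> n x Enx; rewrite lee_fin G0//.
  have : (\bigcup_n E n) x by exists n.
  by rewrite -EP /= in_itv/= andbT.
Unshelve. all: by end_near. Qed.

End ImproperIntegrals.

(** * Derivative rules for real functions and their automation *)

Section RealDerivatives.
Context {R : realType}.
Implicit Types (f g : R -> R) (x a b c p : R).

(** These rules concern abstractions [fun y => ...] and carry the value of the derivative as a
    variable, so that [derivef] assembles a derivative by unification. *)
Lemma derivef_cst c x : is_derive x 1 (fun=> c) 0.
Proof. exact: is_derive_cst. Qed.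

Lemma derivef_id x : is_derive x 1 (fun y : R => y) 1.
Proof. exact: is_derive_id. Qed.

Lemma derivefD f g x a b : is_derive x 1 f a -> is_derive x 1 g b ->
  is_derive x 1 (fun y => f y + g y) (a + b).
Proof. by move=> df dg; exact: is_deriveD. Qed.

Lemma derivefN f x a : is_derive x 1 f a -> is_derive x 1 (fun y => - f y) (- a).
Proof. by move=> df; exact: is_deriveN. Qed.

Lemma derivefM f g x a b : is_derive x 1 f a -> is_derive x 1 g b ->
  is_derive x 1 (fun y => f y * g y) (f x * b + g x * a).
Proof. by move=> df dg; exact: is_deriveM. Qed.

Lemma derivefX f x a n : is_derive x 1 f a ->
  is_derive x 1 (fun y => f y ^+ n) (n%:R * f x ^+ n.-1 * a).
Proof.
move=> df; rewrite (_ : (fun y => f y ^+ n) = f ^+ n); first exact: is_deriveX.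
by apply/funext => y; rewrite exprfctE.
Qed.

Lemma derivefV f x a : f x != 0 -> is_derive x 1 f a ->
  is_derive x 1 (fun y => (f y)^-1) (- f x ^- 2 * a).
Proof.
move=> fx0 df; have [df1 df2] := df; apply: DeriveDef; first exact: derivableV.
by rewrite deriveV// df2.
Qed.

Lemma derivef_comp (h f : R -> R) x a b : is_derive (f x) 1 h b -> is_derive x 1 f a ->
  is_derive x 1 (fun y => h (f y)) (b * a).
Proof. by move=> dh df; exact: (is_derive1_comp dh df). Qed.

Lemma derivef_expR f x a : is_derive x 1 f a ->
  is_derive x 1 (fun y => expR (f y)) (expR (f x) * a).
Proof. by apply: derivef_comp; exact: is_derive_expR. Qed.

Lemma derivef_cos f x a : is_derive x 1 f a ->
  is_derive x 1 (fun y => cos (f y)) (- sin (f x) * a).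
Proof. by apply: derivef_comp; exact: is_derive_cos. Qed.

Lemma derivef_sin f x a : is_derive x 1 f a ->
  is_derive x 1 (fun y => sin (f y)) (cos (f x) * a).
Proof. by apply: derivef_comp; exact: is_derive_sin. Qed.

Lemma derivef_powR f x a p : 0 < f x -> is_derive x 1 f a ->
  is_derive x 1 (fun y => f y `^ p) (p * f x `^ (p - 1) * a).
Proof. by move=> fx0; apply: (@derivef_comp (fun z => z `^ p)); exact: is_derive1_powR. Qed.

Lemma is_derive_continuous f x a : is_derive x 1 f a -> {for x, continuous f}.
Proof.
by move=> [df _]; apply: differentiable_continuous; exact/derivable1_diffP.
Qed.

End RealDerivatives.

(* [apply:] would discharge the [is_derive] premises by instance search, leaving *: terms in
   the derivative; hence the [notypeclasses refine]. *)
Ltac derivef1 := first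
  [ notypeclasses refine (derivef_cst _ _)
  | notypeclasses refine (derivef_id _)
  | notypeclasses refine (derivefN _)
  | notypeclasses refine (derivefV _ _)
  | notypeclasses refine (derivefX _ _)
  | notypeclasses refine (derivef_expR _)
  | notypeclasses refine (derivef_cos _)
  | notypeclasses refine (derivef_sin _)
  | notypeclasses refine (derivef_powR _ _ _)
  | notypeclasses refine (derivefM _ _)
  | notypeclasses refine (derivefD _ _) ].

Ltac derivef := repeat derivef1.

(** Trades the announced derivative for an existential one, to be filled by [derivef], and leaves
    the equality of the two values as a separate goal for [ring] or [field]. *)
Ltac derive_eq := notypeclasses refine (is_derive_eq _ _).

(** * Convergence of Euler's integral *)

Section GammaFunction.
Context {R : realType}.
Notation mu := (@lebesgue_measure R).
Implicit Types (p t c u v : R).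

Lemma powR_cvgy p : 0 < p -> t `^ p @[t --> +oo%R] --> +oo%R.
Proof.
move=> p0; apply/cvgryPge => M; near=> t.
have M0 : 0 <= `|M| `^ p^-1 by exact: powR_ge0.
rewrite (le_trans (ler_norm M))//.
have -> : `|M| = (`|M| `^ p^-1) `^ p.
  by rewrite -powRrM mulVf ?gt_eqF// powRr1.
have Mt : `|M| `^ p^-1 <= t by near: t; exact: nbhs_pinfty_ge.
by apply: ge0_ler_powR; rewrite ?nnegrE ?(ltW p0)// (le_trans M0).
Unshelve. all: by end_near. Qed.

Lemma powRN_cvgy p : 0 < p -> t `^ (- p) @[t --> +oo%R] --> (0 : R).
Proof.
move=> p0; under eq_cvg do rewrite powRN.
apply/gtr0_cvgV0; last exact: powR_cvgy.
by near=> t; apply: powR_gt0; near: t; exact: nbhs_pinfty_gt.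
Unshelve. all: by end_near. Qed.

(** The square matches the denominator in the derivative of -(1 + t^p)^-1, so one bound controls the
    Gamma integrand at both ends in [integrable_gamma]. It also gives t^p exp(-t) <= C t^(-p), hence
    the decay at infinity. *)
Lemma sqr_1DpowR_le_expR p : 0 < p ->
  exists2 C, 0 < C & forall t, 0 < t -> (1 + t `^ p) ^+ 2 * expR (- t) <= C.
Proof.
move=> p0; set N := (Num.truncn p).+1.
(* With y = t^N one has (1 + t^p)^2 <= (2 + y)^2 <= 8 + 2 y^2, the latter by (y - 2)^2 >= 0, and y^2
   <= (2N)! exp(t) by a single Taylor term. *)
exists (8 + 2 * (N.*2)`!%:R) => [|t t0]; first by rewrite ltr_pwDl.
rewrite expRN ler_pdivrMr ?expR_gt0//.
have tpN : t `^ p <= 1 + t ^+ N.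
  have [t1|t1] := leP t 1.
    rewrite (@le_trans _ _ 1)// ?lerDl ?exprn_ge0 ?(ltW t0)//.
    by rewrite -[leRHS](@powRr0 _ t) ger_powR ?t0 ?t1 ?(ltW p0).
  rewrite (@le_trans _ _ (t ^+ N)) ?lerDr//.
  by rewrite -powR_mulrn ?(ltW t0)// ler_powR ?(ltW t1)//; exact/ltW/truncnS_gt.
have tN : 0 <= t ^+ N by rewrite exprn_ge0// ltW.
have t2N : (t ^+ N) ^+ 2 <= (N.*2)`!%:R * expR t.
  have := expR_ge1Dxn (N.*2).-1 (ltW t0); rewrite prednK// => e1.
  rewrite -ler_pdivrMl ?ltr0n ?fact_gt0// -exprM muln2.
  by apply: le_trans e1; rewrite mulrC lerDr.
have tp0 := powR_ge0 t p.
have e1 : 1 <= expR t by rewrite -expR0 ler_expR ltW.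
apply: (@le_trans _ _ ((2 + t ^+ N) ^+ 2)).
  by rewrite lerXn2r ?nnegrE ?addr_ge0//; lra.
rewrite mulrDl -mulrA; apply: (@le_trans _ _ (8 + 2 * (t ^+ N) ^+ 2)); last first.
  by rewrite lerD// ?ler_pM2l// ler_peMr.
by move: (t ^+ N) => y; have := sqr_ge0 (y - 2); lra.
Qed.

Lemma continuous_powR p t : 0 < t -> {for t, continuous (fun t => t `^ p)}.
Proof.
move=> t0; apply: differentiable_continuous; apply/derivable1_diffP.
by apply: derivable_powR; rewrite in_itv/= andbT.
Qed.

Lemma continuous_powR_expRN p t : 0 < t -> {for t, continuous (fun t => t `^ p * expR (- t))}.
Proof.
move=> t0; apply: continuousM; first exact: continuous_powR.
by apply: continuous_comp; [exact: continuousN|exact: continuous_expR].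
Qed.

Lemma integrable_gamma p : 0 < p ->
  mu.-integrable `]0, +oo[ (EFin \o (fun t => t `^ (p - 1) * expR (- t))).
Proof.
move=> p0; have [C C0 HC] := sqr_1DpowR_le_expR p0.
(* an integrable majorant: the derivative of [- (1 + t `^ p)^-1] *)
pose f t := p * t `^ (p - 1) / (1 + t `^ p) ^+ 2.
have D0 t : 0 < 1 + t `^ p by rewrite ltr_pwDl// powR_ge0.
have cf t : 0 < t -> {for t, continuous f}.
  move=> t0; apply: continuousM.
    by apply: continuousM; [exact: cst_continuous|exact: continuous_powR].
  apply: continuousV; first by rewrite gt_eqF// exprn_gt0.
  apply: (@continuous_comp _ _ _ (fun t => 1 + t `^ p) (fun x => x ^+ 2)).
    by apply: continuousD; [exact: cst_continuous|exact: continuous_powR].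
  exact: exprn_continuous.
have f0 t : 0 < t -> 0 <= f t.
  by move=> t0; rewrite divr_ge0 ?mulr_ge0 ?powR_ge0 ?exprn_ge0 ?(ltW p0) ?(ltW (D0 _)).
have If : mu.-integrable `]0, +oo[ (EFin \o f).
  apply/integrableP; split.
    by apply/measurable_EFinP; exact: continuous_measurable_gt0.
  under eq_integral.
    move=> t; rewrite inE/= in_itv/= andbT => t0; rewrite ger0_norm ?f0//.
    over.
  suff -> : (\int[mu]_(t in `]0%R, +oo[) (f t)%:E = (0 - (-1))%:E)%E by rewrite ltry.
  apply: (@ge0_FTC2_gt0 _ f (fun t => - (1 + t `^ p)^-1)) => //.
  - move=> t t0; have Dt : 1 + t `^ p != 0 by rewrite gt_eqF.
    derive_eq; first by derivef.
    rewrite /f; field.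
    done.
  - rewrite -oppr0; apply: cvgN; apply/gtr0_cvgV0; first by near=> t; exact: D0.
    apply/cvgryPge => M; near=> t; rewrite (@le_trans _ _ (t `^ p)) ?lerDr//.
    by near: t; move/cvgryPge: (powR_cvgy p0); apply.
  - apply: cvgN; rewrite -[in X in _ --> X]invr1; apply: cvgV => //.
    rewrite -[in X in _ --> X](addr0 1); apply: cvgD; first exact: cvg_cst.
    exact: powR_cvg0.
have := @integrableZl _ _ _ mu _ (measurable_itv `]0, +oo[) (C / p) _ If.
apply: le_integrable => //.
  by apply/measurable_EFinP; apply: continuous_measurable_gt0 => t; exact: continuous_powR_expRN.
move=> t; rewrite /= in_itv/= andbT => t0; rewrite lee_fin.
rewrite ger0_norm ?mulr_ge0 ?powR_ge0 ?expR_ge0//.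
apply: le_trans (ler_norm _).
rewrite /f; have := HC _ t0; rewrite -ler_pdivlMl ?exprn_gt0// => h.
have -> : C / p * (p * t `^ (p - 1) / (1 + t `^ p) ^+ 2) =
    t `^ (p - 1) * ((1 + t `^ p) ^- 2 * C).
  by field; rewrite !gt_eqF.
by rewrite ler_wpM2l ?powR_ge0.
Unshelve. all: by end_near. Qed.

Lemma integral_gamma p : 0 < p ->
  (\int[mu]_(t in `]0%R, +oo[) (t `^ (p - 1) * expR (- t))%:E = (Gamma p)%:E)%E.
Proof.
move=> p0; rewrite /Gamma /Rintegral fineK//.
by apply: integrable_fin_num => //; exact: integrable_gamma.
Qed.

Lemma cvgy_powR_expRN p : 0 < p -> t `^ p * expR (- t) @[t --> +oo%R] --> (0 : R).
Proof.
move=> p0; have [C C0 HC] := sqr_1DpowR_le_expR p0.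
apply: (@squeeze_cvgr _ _ _ _ (cst 0) (fun t => C * t `^ (- p))).
- near=> t; have t0 : 0 < t by near: t; exact: nbhs_pinfty_gt.
  rewrite mulr_ge0 ?powR_ge0 ?expR_ge0//= powRN ler_pdivlMr ?powR_gt0//.
  apply: le_trans (HC _ t0).
  have := powR_gt0 p t0; have := expR_gt0 (- t); nra.
- exact: cvg_cst.
- by rewrite -[in X in _ --> X](mulr0 C); apply: cvgM; [exact: cvg_cst|exact: powRN_cvgy].
Unshelve. all: by end_near. Qed.

Lemma cvg0_powR_expRN p : 0 < p -> t `^ p * expR (- t) @[t --> 0^'+] --> (0 : R).
Proof.
move=> p0; rewrite -[in X in _ --> X](mul0r (expR (- 0))); apply: cvgM.
  exact: powR_cvg0.
apply: cvg_at_right_filter.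
by apply: continuous_comp; [exact: continuousN|exact: continuous_expR].
Qed.

End GammaFunction.

(** * Gamma integrals with an oscillating factor, and their closed form *)

Section OscillatoryIntegrals.
Context {R : realType}.
Notation mu := (@lebesgue_measure R).
Implicit Types (p t u v : R) (w b T Td : R -> R).

Lemma integrableM_le1 (D : set R) w b : measurable D ->
  mu.-integrable D (EFin \o w) -> measurable_fun D b -> (forall t, `|b t| <= 1) ->
  mu.-integrable D (EFin \o (fun t => w t * b t)).
Proof.
move=> mD Iw mb b1; have /measurable_EFinP mw := measurable_int _ Iw.
apply: le_integrable Iw => //.
  by apply/measurable_EFinP; exact: measurable_funM.
by move=> t _ /=; rewrite lee_fin normrM ler_piMr.
Qed.

Lemma continuous_mulr_comp T v : continuous T -> continuous (fun t => T (t * v)).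
Proof.
move=> cT z; apply: (@continuous_comp _ _ _ (fun t => t * v) T); last exact: cT.
by apply: continuousM; [exact: id|exact: cst_continuous].
Qed.

(** Differentiation under the integral sign. As |Td| <= 1, the function |t w(t)| dominates the
    derivative for every value of the parameter, so the interval ]v - 1, v + 1[ is an arbitrary
    neighbourhood. It serves both the Gamma weights and the Gaussian. *)
Lemma is_derive_Rintegral_osc w T Td v :
  (forall z : R, is_derive z 1 T (Td z)) -> (forall z, `|T z| <= 1) -> (forall z, `|Td z| <= 1) ->
  mu.-integrable `]0, +oo[ (EFin \o w) ->
  mu.-integrable `]0, +oo[ (EFin \o (fun t => t * w t)) ->
  is_derive v 1 (fun v => \int[mu]_(t in `]0, +oo[) (w t * T (t * v)))
    (\int[mu]_(t in `]0, +oo[) (t * w t * Td (t * v))).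
Proof.
move=> dT T_le1 T1_le1 Iw Itw.
have cT : continuous T by move=> z; exact: (is_derive_continuous (dT z)).
have df u t : is_derive u 1 (fun u => w t * T (t * u)) (t * w t * Td (t * u)).
  derive_eq; first by repeat first [notypeclasses refine (derivef_comp (dT _) _)|derivef1].
  rewrite /=; ring.
pose f u t := w t * T (t * u).
have d1f u t : partial1of2 f u t = t * w t * Td (t * u).
  by rewrite partial1of2E /f; have [_ ->] := df u t.
have If u : mu.-integrable `]0, +oo[ (EFin \o f u).
  apply: integrableM_le1 => //; apply: measurable_funTS; apply: continuous_measurable_fun.
  exact: continuous_mulr_comp.
have := @cvg_differentiation_under_integral R _ _ mu f _ (measurable_itv `]0, +oo[)
  v (v - 1) (v + 1).
have vI : `](v - 1), (v + 1)[%classic v by rewrite /= in_itv/=; lra.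
move=> /(_ vI (fun u _ => If u)) h.
have {}h := h (fun u t _ _ => @ex_derive _ _ _ _ _ _ _ (df u t)) (fun t => `|t * w t|)
  (fun t => normr_ge0 _) (integrable_norm Itw).
have {}h : h^-1 *: ((\int[mu]_(t in `]0, +oo[) f (h + v) t) - \int[mu]_(t in `]0, +oo[) f v t)
   @[h --> 0^'] --> \int[mu]_(t in `]0, +oo[) (t * w t * Td (t * v)).
  rewrite (_ : (\int[mu]_(t in `]0, +oo[) (t * w t * Td (t * v))) =
     \int[mu]_(t in `]0, +oo[) partial1of2 f v t); last first.
    by apply: eq_Rintegral => t _; rewrite d1f.
  by apply: h => u t _ _; rewrite d1f normrM ler_piMr.
apply: DeriveDef.
  apply/cvg_ex; eexists; under eq_fun do rewrite scaler1.
  exact: h.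
rewrite /derive; under eq_fun do rewrite scaler1.
exact/cvg_lim.
Qed.

(** The integral of t^(p-1) exp(-t (1 + iv)) has real part [gamma_cos p v] and imaginary part
    [- gamma_sin p v]. *)
Definition gamma_cos p v : R := \int[mu]_(t in `]0, +oo[) (t `^ (p - 1) * expR (- t) * cos (t * v)).
Definition gamma_sin p v : R := \int[mu]_(t in `]0, +oo[) (t `^ (p - 1) * expR (- t) * sin (t * v)).

Lemma integrable_gammaM p T v : 0 < p -> continuous T -> (forall z, `|T z| <= 1) ->
  mu.-integrable `]0, +oo[ (EFin \o (fun t => t `^ (p - 1) * expR (- t) * T (t * v))).
Proof.
move=> p0 cT Td; apply: integrableM_le1 => //; first exact: integrable_gamma.
by apply: measurable_funTS; apply: continuous_measurable_fun; exact: continuous_mulr_comp.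
Qed.

Lemma integrable_gammaS p : 0 < p ->
  mu.-integrable `]0, +oo[ (EFin \o (fun t => t * (t `^ (p - 1) * expR (- t)))).
Proof.
move=> p0; have := @integrable_gamma R (p + 1) ltac:(lra).
apply: eq_integrable => // t; rewrite inE/= in_itv/= andbT => t0.
by rewrite addrK mulrA mulr_powRB1 ?(ltW t0).
Qed.

Lemma Rintegral_gammaS p T v : 0 < p ->
  \int[mu]_(t in `]0, +oo[) (t * (t `^ (p - 1) * expR (- t)) * T (t * v)) =
  \int[mu]_(t in `]0, +oo[) (t `^ (p + 1 - 1) * expR (- t) * T (t * v)).
Proof.
move=> p0; apply: eq_Rintegral => t; rewrite inE/= in_itv/= andbT => t0.
by rewrite addrK mulrA mulr_powRB1 ?(ltW t0).
Qed.

Lemma is_derive_gamma_cos p v : 0 < p ->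
  is_derive v 1 (gamma_cos p) (- gamma_sin (p + 1) v).
Proof.
move=> p0; rewrite /gamma_cos /gamma_sin -(Rintegral_gammaS sin)//.
have := @is_derive_Rintegral_osc (fun t => t `^ (p - 1) * expR (- t)) cos (\- sin) v.
move=> /(_ (@is_derive_cos _) (@cos_max _)) h.
have -> : - (\int[mu]_(t in `]0, +oo[) (t * (t `^ (p - 1) * expR (- t)) * sin (t * v))) =
   \int[mu]_(t in `]0, +oo[) (t * (t `^ (p - 1) * expR (- t)) * (- sin (t * v))).
  rewrite -[LHS]mulN1r -RintegralZl//; last first.
    apply: integrableM_le1 => //; first exact: integrable_gammaS.
      apply: measurable_funTS; apply: continuous_measurable_fun.
      by apply: continuous_mulr_comp; exact: continuous_sin.
    by move=> t; exact: sin_max.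
  by apply: eq_Rintegral => t _; rewrite mulrN mulN1r.
apply: h; last exact: integrable_gammaS; last exact: integrable_gamma.
by move=> z; rewrite /= normrN sin_max.
Qed.

Lemma is_derive_gamma_sin p v : 0 < p ->
  is_derive v 1 (gamma_sin p) (gamma_cos (p + 1) v).
Proof.
move=> p0; rewrite /gamma_cos /gamma_sin -(Rintegral_gammaS cos)//.
apply: is_derive_Rintegral_osc.
- exact: sin_max.
- exact: cos_max.
- exact: integrable_gamma.
- exact: integrable_gammaS.
Qed.

(** Integration by parts: the boundary term t^p exp(-t) T(tv) vanishes at 0 since p > 0, and at
    infinity since T is bounded. The exponent [p + 1 - 1] is left as it is in order to match
    [gamma_cos (p + 1)] and [gamma_sin (p + 1)]. *)
Lemma gamma_ibp p v T Td : 0 < p ->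
  (forall z : R, is_derive z 1 T (Td z)) -> continuous Td ->
  (forall z, `|T z| <= 1) -> (forall z, `|Td z| <= 1) ->
  p * (\int[mu]_(t in `]0, +oo[) (t `^ (p - 1) * expR (- t) * T (t * v))) =
  \int[mu]_(t in `]0, +oo[) (t `^ (p + 1 - 1) * expR (- t) * T (t * v)) -
  v * (\int[mu]_(t in `]0, +oo[) (t `^ (p + 1 - 1) * expR (- t) * Td (t * v))).
Proof.
move=> p0 dT cT1 T_le1 T1_le1.
have p1 : 0 < p + 1 by lra.
have cT : continuous T by move=> z; exact: (is_derive_continuous (dT z)).
have mD : measurable (`]0, +oo[%classic : set R) by exact: measurable_itv.
have I0 := integrable_gammaM v p0 cT T_le1.
have I1 := integrable_gammaM v p1 cT T_le1.
have I2 := integrable_gammaM v p1 cT1 T1_le1.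
(* The derivative of t^p exp(-t) T(tv), so its integral is zero. *)
pose f t := p * (t `^ (p - 1) * expR (- t) * T (t * v)) -
  (t `^ (p + 1 - 1) * expR (- t) * T (t * v)) +
  v * (t `^ (p + 1 - 1) * expR (- t) * Td (t * v)).
have cI (q : R) S t : continuous S -> 0 < t ->
    {for t, continuous (fun t => t `^ q * expR (- t) * S (t * v))}.
  move=> cS t0; apply: continuousM; first exact: continuous_powR_expRN.
  by apply: continuous_mulr_comp.
have I0' : mu.-integrable `]0, +oo[
    (EFin \o (fun t => p * (t `^ (p - 1) * expR (- t) * T (t * v)))).
  exact: (@integrableZl _ _ _ mu _ mD p _ I0).
have I2' : mu.-integrable `]0, +oo[
    (EFin \o (fun t => v * (t `^ (p + 1 - 1) * expR (- t) * Td (t * v)))).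
  exact: (@integrableZl _ _ _ mu _ mD v _ I2).
have I01 : mu.-integrable `]0, +oo[
    (EFin \o (fun t => p * (t `^ (p - 1) * expR (- t) * T (t * v)) -
      (t `^ (p + 1 - 1) * expR (- t) * T (t * v)))).
  exact: (@integrableB _ _ _ mu _ mD _ _ I0' I1).
have If : mu.-integrable `]0, +oo[ (EFin \o f).
  exact: (@integrableD _ _ _ mu _ mD _ _ I01 I2').
have : \int[mu]_(t in `]0, +oo[) f t = 0 - 0.
  apply: (@Rintegral_FTC2_gt0 _ f (fun t => t `^ p * expR (- t) * T (t * v)) 0 0 If).
  - move=> t t0; apply: continuousD; first apply: continuousB.
    + by apply: continuousM; [exact: cst_continuous|exact: cI].
    + exact: cI.
    + by apply: continuousM; [exact: cst_continuous|exact: cI].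
  - move=> t t0.
    derive_eq; first by repeat first [notypeclasses refine (derivef_comp (dT _) _)|derivef1].
    rewrite /f addrK /=; ring.
  - apply: (@squeeze_cvgr _ _ _ _ (fun t => - (t `^ p * expR (- t)))
      (fun t => t `^ p * expR (- t))).
    + near=> t; rewrite -ler_norml normrM ger0_norm ?mulr_ge0 ?powR_ge0 ?expR_ge0//.
      by rewrite ler_piMr ?mulr_ge0 ?powR_ge0 ?expR_ge0.
    + by rewrite -oppr0; apply: cvgN; exact: cvgy_powR_expRN.
    + exact: cvgy_powR_expRN.
  - apply: (@squeeze_cvgr _ _ _ _ (fun t => - (t `^ p * expR (- t)))
      (fun t => t `^ p * expR (- t))).
    + near=> t; rewrite -ler_norml normrM ger0_norm ?mulr_ge0 ?powR_ge0 ?expR_ge0//.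
      by rewrite ler_piMr ?mulr_ge0 ?powR_ge0 ?expR_ge0.
    + by rewrite -[in X in _ --> X]oppr0; apply: cvgN; exact: cvg0_powR_expRN.
    + exact: cvg0_powR_expRN.
rewrite /f RintegralD// RintegralB// !RintegralZl// subr0.
by move: (\int[mu]_(_ in _) _) (\int[mu]_(_ in _) _) (\int[mu]_(_ in _) _) => a b c; lra.
Unshelve. all: by end_near. Qed.

(** Together with [gamma_sinS], the two components of p I_p = (1 + iv) I_(p+1), where I_p is the
    complex Gamma integral. At v = 0 this becomes the functional equation [GammaS]. *)
Lemma gamma_cosS p v : 0 < p ->
  p * gamma_cos p v = gamma_cos (p + 1) v + v * gamma_sin (p + 1) v.
Proof.
move=> p0; rewrite /gamma_cos (gamma_ibp v p0 (@is_derive_cos _)) //.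
- rewrite -mulrN; congr (_ + v * _); rewrite /gamma_sin.
  rewrite -[LHS]mulN1r -RintegralZl//; last first.
    apply: (@integrable_gammaM (p + 1) (\- sin)); first lra.
      by move=> z; apply: continuousN; exact: continuous_sin.
    by move=> z; rewrite /= normrN sin_max.
  by apply: eq_Rintegral => t _; rewrite mulrN mulN1r opprK.
- by move=> z; apply: continuousN; exact: continuous_sin.
- exact: cos_max.
- by move=> z; rewrite /= normrN sin_max.
Qed.

Lemma gamma_sinS p v : 0 < p ->
  p * gamma_sin p v = gamma_sin (p + 1) v - v * gamma_cos (p + 1) v.
Proof.
move=> p0; rewrite /gamma_sin (gamma_ibp v p0 (@is_derive_sin _)) //.
- exact: continuous_cos.
- exact: sin_max.
- exact: cos_max.
Qed.

Lemma gamma_cos0 p : gamma_cos p 0 = Gamma p.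
Proof. by apply: eq_Rintegral => t _; rewrite mulr0 cos0 mulr1. Qed.

Lemma gamma_sin0 p : gamma_sin p 0 = 0.
Proof.
rewrite /gamma_sin; under eq_Rintegral do rewrite mulr0 sin0 mulr0.
by rewrite /Rintegral integral0.
Qed.

Lemma GammaS p : 0 < p -> Gamma (p + 1) = p * Gamma p :> R.
Proof. by move=> p0; rewrite -!gamma_cos0 gamma_cosS// mul0r addr0. Qed.

Lemma gamma_cos_sinE p v : 0 < p ->
  gamma_cos p v = Gamma p * (1 + v ^+ 2) `^ (- (p / 2)) * cos (p * atan v) /\
  gamma_sin p v = Gamma p * (1 + v ^+ 2) `^ (- (p / 2)) * sin (p * atan v).
Proof.
move=> p0.
have D0 (u : R) : 0 < 1 + u ^+ 2 by rewrite ltr_pwDl// sqr_ge0.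
pose rho (u : R) := (1 + u ^+ 2) `^ (p / 2).
(* [U] and [W] are the real and imaginary parts of (1 + iu)^p times the integral of
   t^(p-1) exp(-t (1 + iu)); both have zero derivative *)
pose U u := rho u * (gamma_cos p u * cos (p * atan u) + gamma_sin p u * sin (p * atan u)).
pose W u := rho u * (gamma_cos p u * sin (p * atan u) - gamma_sin p u * cos (p * atan u)).
have drho u : is_derive u 1 rho (rho u * (p * u / (1 + u ^+ 2))).
  have Du := D0 u.
  derive_eq; first by rewrite /rho; derivef.
  rewrite /rho /= powRB; last by rewrite (gt_eqF Du) implybT.
  rewrite powRr1 ?(ltW Du)//.
  by field; rewrite gt_eqF.
have dat u : is_derive u 1 (fun u => p * atan u) (p / (1 + u ^+ 2)).
  derive_eq; first by repeat first [exact: is_derive1_atan|derivef1].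
  rewrite /=; ring.
(* The two recurrences form a linear system of determinant 1 + u^2. Solving it expresses the
   derivatives of [gamma_cos p] and [gamma_sin p] through these two functions alone. *)
have cs u : gamma_cos (p + 1) u = p * (gamma_cos p u - u * gamma_sin p u) / (1 + u ^+ 2).
  apply: (mulIf (lt0r_neq0 (D0 u))); rewrite divfK ?gt_eqF//.
  have := gamma_cosS u p0; have := gamma_sinS u p0.
  move: (gamma_cos (p + 1) u) (gamma_sin (p + 1) u) (gamma_cos p u) (gamma_sin p u).
  by move=> C S A B hS hC; rewrite [RHS]mulrBr [X in _ - X]mulrCA hC hS; ring.
have sn u : gamma_sin (p + 1) u = p * (gamma_sin p u + u * gamma_cos p u) / (1 + u ^+ 2).
  apply: (mulIf (lt0r_neq0 (D0 u))); rewrite divfK ?gt_eqF//.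
  have := gamma_cosS u p0; have := gamma_sinS u p0.
  move: (gamma_cos (p + 1) u) (gamma_sin (p + 1) u) (gamma_cos p u) (gamma_sin p u).
  by move=> C S A B hS hC; rewrite [RHS]mulrDr [in RHS]mulrCA hC hS; ring.
have dU u : is_derive u 1 U 0.
  derive_eq.
    rewrite /U; repeat first [exact: drho | exact: is_derive_gamma_cos
      | exact: is_derive_gamma_sin | exact: dat | derivef1].
  rewrite /= cs sn; move: (D0 u) (gamma_cos _ _) (gamma_sin _ _) => Du A B.
  by field; rewrite gt_eqF.
have dW u : is_derive u 1 W 0.
  derive_eq.
    rewrite /W; repeat first [exact: drho | exact: is_derive_gamma_cos
      | exact: is_derive_gamma_sin | exact: dat | derivef1].
  rewrite /= cs sn; move: (D0 u) (gamma_cos _ _) (gamma_sin _ _) => Du A B.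
  by field; rewrite gt_eqF.
have rho0 : rho 0 = 1 by rewrite /rho expr0n addr0 powR1.
have Uv : U v = Gamma p.
  rewrite (@is_derive_0_is_cst _ U v 0 dU) /U rho0 atan0 mulr0 cos0 sin0 mulr0 addr0 !mulr1 mul1r.
  exact: gamma_cos0.
have Wv : W v = 0.
  rewrite (@is_derive_0_is_cst _ W v 0 dW) /W gamma_sin0 atan0 mulr0 sin0.
  by rewrite mul0r mulr0 subrr mulr0.
have rv : 0 < rho v by exact: powR_gt0.
rewrite powRN -/(rho v).
(* It remains to invert a rotation. With A, B the two integrals and c, s the cosine and sine of p
   atan(v), the relation A s = B c and c^2 + s^2 = 1 give A = (A c + B s) c and B = (A c + B s)
   s. *)
have cs2 := cos2Dsin2 (p * atan v).
move: Uv Wv; rewrite /U /W => <- /eqP; rewrite mulf_eq0 gt_eqF//= => /eqP w0.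
move: cs2 w0; move: (cos _) (sin _) (gamma_cos _ _) (gamma_sin _ _) (rho v) rv => c s A B r r0 cs2 w0.
have r1 : r != 0 by rewrite gt_eqF.
have -> : r * (A * c + B * s) / r = A * c + B * s by rewrite mulrAC divff// mul1r.
split.
- rewrite mulrDl -mulrA -expr2 -[LHS]mulr1 -cs2 mulrDr; congr (_ + _).
  by rewrite expr2 mulrA; move/eqP: w0; rewrite subr_eq0 => /eqP ->; ring.
- rewrite mulrDl -[_ * s * s]mulrA -expr2 -[LHS]mulr1 -cs2 mulrDr; congr (_ + _).
  by rewrite expr2 mulrA; move/eqP: w0; rewrite subr_eq0 => /eqP <-; ring.
Qed.

End OscillatoryIntegrals.

(** * Tonelli and Fubini on a product of two sets *)

Section IteratedIntegrals.
Context {R : realType}.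
Notation mu := (@lebesgue_measure R).
Local Open Scope ereal_scope.
Implicit Types (A B : set R) (f : R * R -> \bar R).

(** Extension by zero off the product set carries iterated integrals to the whole plane, where the
    theorems on product measures apply. *)
Lemma iterated_integral_mkcond A B f :
  \int[mu]_(x in A) \int[mu]_(y in B) f (x, y) =
  \int[mu]_x \int[mu]_y (f \_ (A `*` B)) (x, y).
Proof.
rewrite integral_mkcond; apply: eq_integral => x _; rewrite patchE.
case: ifPn => xA; last first.
  rewrite integral0_eq// => y _; rewrite patchE ifF//.
  by apply: contraNF xA; rewrite !inE => -[].
rewrite integral_mkcond; apply: eq_integral => y _; rewrite !patchE.
by congr (if _ then _ else _); apply/idP/idP; rewrite !inE; [split => //=; rewrite -inE|case].
Qed.

Lemma iterated_integral_mkcond_swap A B f :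
  \int[mu]_(y in B) \int[mu]_(x in A) f (x, y) =
  \int[mu]_y \int[mu]_x (f \_ (A `*` B)) (x, y).
Proof.
rewrite integral_mkcond; apply: eq_integral => y _; rewrite patchE.
case: ifPn => yB; last first.
  rewrite integral0_eq// => x _; rewrite patchE ifF//.
  by apply: contraNF yB; rewrite !inE => -[].
rewrite integral_mkcond; apply: eq_integral => x _; rewrite !patchE.
by congr (if _ then _ else _); apply/idP/idP; rewrite !inE; [split => //=; rewrite -inE|case].
Qed.

Lemma tonelli_setX A B f : measurable A -> measurable B -> measurable_fun setT f ->
  (forall x y, A x -> B y -> 0 <= f (x, y)) ->
  \int[mu]_(x in A) \int[mu]_(y in B) f (x, y) =
  \int[mu]_(y in B) \int[mu]_(x in A) f (x, y).
Proof.
move=> mA mB mf f0; rewrite iterated_integral_mkcond iterated_integral_mkcond_swap.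
apply: (@fubini_tonelli _ _ _ _ _ mu mu (f \_ (A `*` B))).
  apply/(measurable_restrictT _ (measurableX mA mB)).
  exact: measurable_funTS.
move=> [x y]; rewrite patchE; case: ifPn => // /[!inE] -[]; exact: f0.
Qed.

(** Finiteness is asked with the integral over x inside: in [integrable_second_difference] that
    inner integral has a closed form. Tonelli converts it to the other order. The first conclusion
    makes the partial integral itself integrable, as the principal value requires. *)
Lemma fubini_setX A B f : measurable A -> measurable B -> measurable_fun setT f ->
  \int[mu]_(y in B) \int[mu]_(x in A) `|f (x, y)| < +oo ->
  mu.-integrable A (fun x => \int[mu]_(y in B) f (x, y)) /\
  \int[mu]_(x in A) \int[mu]_(y in B) f (x, y) =
  \int[mu]_(y in B) \int[mu]_(x in A) f (x, y).
Proof.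
move=> mA mB mf fty0.
have maf : measurable_fun setT (abse \o f) by apply: measurableT_comp mf; exact: abse_measurable.
have fty : \int[mu]_(x in A) \int[mu]_(y in B) `|f (x, y)| < +oo.
  have := tonelli_setX mA mB maf; rewrite /comp => -> //.
have mAB : measurable (A `*` B) by exact: measurableX.
have mF : measurable_fun setT (f \_ (A `*` B)).
  by apply/(measurable_restrictT _ mAB); exact: measurable_funTS.
have IF : (mu \x mu).-integrable setT (f \_ (A `*` B)).
  apply/integrable12ltyP; first exact: mF.
  apply: le_lt_trans fty.
  rewrite (iterated_integral_mkcond A B (abse \o f)) le_eqVlt; apply/orP; left; apply/eqP.
  apply: eq_integral => x _; apply: eq_integral => y _; rewrite !patchE.
  by case: ifPn => //; rewrite abse0.
split.
  apply/integrable_mkcond => //.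
  have := integrable_fubini_F IF; apply: eq_integrable => // x _.
  rewrite /fubini_F patchE; case: ifPn => xA; last first.
    rewrite integral0_eq// => y _; rewrite patchE ifF//.
    by apply: contraNF xA; rewrite !inE => -[].
  rewrite [RHS]integral_mkcond; apply: eq_integral => y _; rewrite !patchE.
  by congr (if _ then _ else _); apply/idP/idP; rewrite !inE; [case|split => //=; rewrite -inE].
rewrite iterated_integral_mkcond iterated_integral_mkcond_swap.
exact: (Fubini IF).
Qed.

End IteratedIntegrals.

(** * Gaussian moments, the Fourier transform of the Gaussian, and power integrals *)

Section GaussianIntegrals.
Context {R : realType}.
Notation mu := (@lebesgue_measure R).
Implicit Types (p t u v c y : R).

Lemma integral_scale (G : R -> R) c : 0 < c ->
  (forall x : R, 0 < x -> {for x, continuous G}) -> (forall x : R, 0 < x -> 0 <= G x) ->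
  (\int[mu]_(x in `]0%R, +oo[) (G x)%:E = \int[mu]_(x in `]0%R, +oo[) (G (c * x) * c)%:E)%E.
Proof.
move=> c0 cG G0; apply: (@ge0_integration_by_substitution_gt0 R (fun x => c * x) (fun=> c)) => //.
- by move=> x x0; rewrite mulr_gt0.
- by move=> x _; exact: ltW.
- by move=> x y _ xy; rewrite ltr_pM2l.
- by move=> x _; derive_eq; [derivef|rewrite /=; ring].
- by move=> x _; exact: cst_continuous.
- rewrite -[in X in _ --> X](mulr0 c); apply: cvg_at_right_filter.
  by apply: continuousM; [exact: cst_continuous|exact: id].
- by under eq_cvg do rewrite mulrC; exact: gt0_cvgMly.
Qed.

Lemma integral_scale_sqr (G : R -> R) c : 0 < c ->
  (forall x : R, 0 < x -> {for x, continuous G}) -> (forall x : R, 0 < x -> 0 <= G x) ->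
  (\int[mu]_(x in `]0%R, +oo[) (G x)%:E =
   \int[mu]_(x in `]0%R, +oo[) (G (c * x ^+ 2) * (2 * c * x))%:E)%E.
Proof.
move=> c0 cG G0.
have c2 : 0 < 2 * c by rewrite mulr_gt0.
have dF (x : R) : is_derive x 1 (fun x => c * x ^+ 2) (2 * c * x).
  by derive_eq; [derivef|rewrite /=; ring].
apply: (@ge0_integration_by_substitution_gt0 R (fun x => c * x ^+ 2) (fun x => 2 * c * x)) => //.
- by move=> x x0; rewrite mulr_gt0// exprn_gt0.
- by move=> x x0; rewrite ltW// mulr_gt0.
- by move=> x y x0 xy; rewrite ltr_pM2l// ltrXn2r ?nnegrE ?(ltW x0) ?(ltW (lt_trans x0 xy)).
- by move=> x _; apply: continuousM; [exact: cst_continuous|exact: id].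
- rewrite [X in _ --> X](_ : 0 = c * 0 ^+ 2); last by rewrite expr0n mulr0.
  by apply: cvg_at_right_filter; exact: (is_derive_continuous (dF 0)).
- under eq_cvg do rewrite mulrC.
  apply: gt0_cvgMly => //; apply/cvgryPge => M; near=> x.
  have x1 : `|M| + 1 <= x by near: x; exact: nbhs_pinfty_ge.
  have := ler_norm M; have := normr_ge0 M; rewrite expr2; nra.
Unshelve. all: by end_near. Qed.

(** Substitution t = u y^2 in Euler's integral for Gamma((p + 1)/2); with q = (p + 1)/2, the
    prefactor u^(-q)/2 compensates for t^(q-1) and dt = 2 u y dy. *)
Lemma integral_powR_gauss p u : 0 < p + 1 -> 0 < u ->
  (\int[mu]_(y in `]0%R, +oo[) (y `^ p * expR (- (u * y ^+ 2)))%:E =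
   (Gamma ((p + 1) / 2) / 2 * u `^ (- ((p + 1) / 2)))%:E)%E.
Proof.
move=> p1 u0; set q := (p + 1) / 2.
have q0 : 0 < q by rewrite divr_gt0.
pose G t := t `^ (q - 1) * expR (- t).
have cG (x : R) : 0 < x -> {for x, continuous G} by exact: continuous_powR_expRN.
have G0 (x : R) : 0 < x -> 0 <= G x by move=> _; rewrite mulr_ge0 ?powR_ge0 ?expR_ge0.
transitivity (\int[mu]_(y in `]0%R, +oo[)
   ((u `^ (- q) / 2)%:E * (G (u * y ^+ 2)%R * (2 * u * y))%:E))%E.
  apply: eq_integral => y; rewrite inE/= in_itv/= andbT => y0.
  rewrite -EFinM /G; congr (_%:E).
  have u0' : u != 0 by rewrite gt_eqF.
  have -> : (u * y ^+ 2) `^ (q - 1) = u `^ q / u * (y `^ p / y).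
    rewrite powRM ?(ltW u0) ?exprn_ge0 ?(ltW y0)// powRB ?u0' ?implybT// powRr1 ?(ltW u0)//.
    congr (_ * _); rewrite -powR_mulrn ?(ltW y0)// -powRrM.
    rewrite (_ : 2%:R * (q - 1) = p - 1); last by rewrite /q; field.
    by rewrite powRB ?powRr1 ?(ltW y0)// (gt_eqF y0) implybT.
  rewrite powRN; have : u `^ q != 0 by rewrite gt_eqF// powR_gt0.
  move: (u `^ q) => w w0; field.
  by rewrite w0 u0' gt_eqF.
rewrite ge0_integralZl_EFin//.
- rewrite -(integral_scale_sqr u0 cG G0) integral_gamma// -EFinM.
  by congr (_%:E); ring.
- by move=> y /=; rewrite in_itv/= andbT => y0;
    rewrite lee_fin mulr_ge0 ?G0 ?mulr_gt0 ?exprn_gt0// ltW// !mulr_gt0.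
- apply/measurable_EFinP; apply: continuous_measurable_gt0 => y y0.
  apply: continuousM.
    apply: (@continuous_comp _ _ _ (fun y => u * y ^+ 2) G); last by apply: cG; rewrite mulr_gt0 ?exprn_gt0.
    by apply: continuousM; [exact: cst_continuous|exact: exprn_continuous].
  by apply: continuousM; [exact: cst_continuous|exact: id].
- by rewrite divr_ge0 ?powR_ge0.
Qed.

Lemma integrable_gauss_gt0 :
  mu.-integrable `]0, +oo[ (EFin \o (fun t : R => expR (- t ^+ 2))).
Proof.
have mD : measurable (`]0, +oo[%classic : set R) by exact: measurable_itv.
apply: (@integrableS _ _ R mu setT) => //.
exact: (@integrableT_gauss R).
Qed.

Lemma integrable_mul_gauss_gt0 :
  mu.-integrable `]0, +oo[ (EFin \o (fun t : R => t * expR (- t ^+ 2))).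
Proof.
apply/integrableP; split.
  apply/measurable_EFinP; apply: measurable_funM => //.
  by apply: measurable_funTS; exact: measurable_gauss_fun.
rewrite (_ : (\int[mu]_(x in _) _)%E =
  \int[mu]_(y in `]0%R, +oo[) (y `^ 1 * expR (- (1 * y ^+ 2)))%:E)%E.
  by rewrite integral_powR_gauss// ltry.
apply: eq_integral => t; rewrite inE/= in_itv/= andbT => t0.
by rewrite powRr1 ?(ltW t0)// mul1r ger0_norm// mulr_ge0 ?expR_ge0 ?(ltW t0).
Qed.

(** Differentiating in z and integrating by parts in t gives g'(z) = -(z/2) g(z), so g(z) exp(z^2/4)
    is constant; its value at 0 is the Gaussian integral. *)
Lemma Rintegral_gauss_cos y :
  \int[mu]_(t in `]0, +oo[) (expR (- t ^+ 2) * cos (t * y)) =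
  Num.sqrt pi / 2 * expR (- (y ^+ 2 / 4)).
Proof.
have mD : measurable (`]0, +oo[%classic : set R) by exact: measurable_itv.
pose g z := \int[mu]_(t in `]0, +oo[) (expR (- t ^+ 2) * cos (t * z)).
pose k z := \int[mu]_(t in `]0, +oo[) (t * expR (- t ^+ 2) * (- sin (t * z))).
have cM (T : R -> R) z : continuous T -> measurable_fun (`]0, +oo[%classic : set R) (fun t => T (t * z)).
  move=> cT; apply: measurable_funTS; apply: continuous_measurable_fun.
  exact: continuous_mulr_comp.
have cNs : continuous (fun z : R => - sin z) by move=> z; apply: continuousN; exact: continuous_sin.
have dg (z : R) : is_derive z 1 g (k z).
  apply: (@is_derive_Rintegral_osc _ _ cos (fun z => - sin z)).
  - exact: cos_max.
  - by move=> x; rewrite normrN sin_max.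
  - exact: integrable_gauss_gt0.
  - exact: integrable_mul_gauss_gt0.
have kE z : k z = - (z / 2) * g z.
  have I1 : mu.-integrable `]0, +oo[ (EFin \o (fun t => t * expR (- t ^+ 2) * (- sin (t * z)))).
    apply: integrableM_le1 => //; first exact: integrable_mul_gauss_gt0.
      exact: (cM (fun z => - sin z)).
    by move=> x; rewrite normrN sin_max.
  have I2 : mu.-integrable `]0, +oo[ (EFin \o (fun t => expR (- t ^+ 2) * cos (t * z))).
    apply: integrableM_le1 => //; first exact: integrable_gauss_gt0.
      by apply: cM; exact: continuous_cos.
    by move=> x; exact: cos_max.
  have I1' : mu.-integrable `]0, +oo[ (EFin \o (fun t => 2 * (t * expR (- t ^+ 2) * (- sin (t * z))))).
    exact: (@integrableZl _ _ _ mu _ mD 2 _ I1).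
  have I2' : mu.-integrable `]0, +oo[ (EFin \o (fun t => z * (expR (- t ^+ 2) * cos (t * z)))).
    exact: (@integrableZl _ _ _ mu _ mD z _ I2).
  (* The derivative of exp(-t^2) sin(tz); the vanishing of its integral reads 2 k(z) + z g(z) =
     0. *)
  pose f t := 2 * (t * expR (- t ^+ 2) * (- sin (t * z))) + z * (expR (- t ^+ 2) * cos (t * z)).
  have If : mu.-integrable `]0, +oo[ (EFin \o f).
    exact: (@integrableD _ _ _ mu _ mD _ _ I1' I2').
  have dF (t : R) : is_derive t 1 (fun t => expR (- t ^+ 2) * sin (t * z)) (f t).
    by derive_eq; [derivef|rewrite /f/=; ring].
  have : \int[mu]_(t in `]0, +oo[) f t = 0 - 0.
    apply: (@Rintegral_FTC2_gt0 _ f (fun t => expR (- t ^+ 2) * sin (t * z)) 0 0 If) => //.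
    - by move=> t _; notypeclasses refine (is_derive_continuous _); rewrite /f; derivef.
    - apply: (@squeeze_cvgr _ _ _ _ (fun t => - expR (- t ^+ 2)) (fun t => expR (- t ^+ 2))).
      + near=> t; rewrite -ler_norml normrM ger0_norm ?expR_ge0//.
        by rewrite ler_piMr ?expR_ge0// sin_max.
      + by rewrite -[in X in _ --> X]oppr0; apply: cvgN; exact: cvg_gauss_fun.
      + exact: cvg_gauss_fun.
    - apply: cvg_at_right_filter.
      have := is_derive_continuous (dF 0); rewrite /prop_for /continuous_at.
      by rewrite mul0r sin0 mulr0.
  rewrite /f RintegralD// !RintegralZl// subr0 -/(g z) -/(k z) => e.
  by move: e; move: (k z) (g z) => a b e; lra.
pose E z := g z * expR (z ^+ 2 / 4).
have dE (z : R) : is_derive z 1 E 0.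
  derive_eq; first by rewrite /E; repeat first [exact: dg | derivef1].
  by rewrite /= kE; move: (g z) => G; field.
have E0 : E 0 = Num.sqrt pi / 2.
  rewrite /E expr0n/= mul0r expR0 mulr1 /g.
  rewrite -[RHS]/(fine (Num.sqrt pi / 2)%:E) -integral0y_gauss /Rintegral.
  rewrite -integral_itv_obnd_cbnd; last first.
    by apply/measurable_EFinP; apply: measurable_funTS; exact: measurable_gauss_fun.
  by congr fine; apply: eq_integral => t _; rewrite mulr0 cos0 mulr1.
have := @is_derive_0_is_cst _ E y 0 dE; rewrite E0 /E -/(g y) => <-.
by rewrite -mulrA -expRD subrr expR0 mulr1.
Unshelve. all: by end_near. Qed.

Lemma integral_gauss_1Bcos y :
  (\int[mu]_(t in `]0%R, +oo[) (expR (- t ^+ 2) * (1 - cos (t * y)))%:E =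
   (Num.sqrt pi / 2 * (1 - expR (- (y ^+ 2 / 4))))%:E)%E.
Proof.
have mD : measurable (`]0, +oo[%classic : set R) by exact: measurable_itv.
have I0 := integrable_gauss_gt0.
have Icos z : mu.-integrable `]0, +oo[ (EFin \o (fun t : R => expR (- t ^+ 2) * cos (t * z))).
  apply: integrableM_le1 => //; last by move=> t; exact: cos_max.
  apply: measurable_funTS; apply: continuous_measurable_fun.
  by apply: continuous_mulr_comp; exact: continuous_cos.
(* Writing 1 as cos(t * 0) makes both terms instances of [Rintegral_gauss_cos]. *)
transitivity (\int[mu]_(t in `]0%R, +oo[) ((expR (- t ^+ 2) * cos (t * 0)) -
    (expR (- t ^+ 2) * cos (t * y)))%:E)%E.
  by apply: eq_integral => t _; rewrite mulr0 cos0 mulrBr.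
have IB := @integrableB _ _ _ mu _ mD _ _ (Icos 0) (Icos y).
rewrite -[LHS]fineK; last exact: integrable_fin_num.
congr (_%:E); rewrite -[LHS]/(Rintegral mu _ _) RintegralB// !Rintegral_gauss_cos.
by rewrite expr0n/= mul0r oppr0 expR0 mulrBr.
Qed.

Lemma integral_powRN_tail c p : 0 < c -> 0 < p ->
  (\int[mu]_(y in `[c, +oo[) (y `^ (- 1 - p))%:E = (c `^ (- p) / p)%:E)%E.
Proof.
move=> c0 p0.
have dF y : 0 < y -> is_derive y 1 (fun y => - (y `^ (- p) / p)) (y `^ (- 1 - p)).
  move=> y0; derive_eq; first by derivef.
  by rewrite (_ : - p - 1 = - 1 - p) /=; [field; rewrite gt_eqF|ring].
rewrite (@ge0_continuous_FTC2y _ _ (fun y => - (y `^ (- p) / p)) c 0).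
- by rewrite -EFinB sub0r opprK.
- by move=> y _; exact: powR_ge0.
- apply: continuous_in_subspaceT => y; rewrite inE/= in_itv/= andbT => cy.
  by apply: continuous_powR; exact: lt_le_trans cy.
- rewrite -[in X in _ --> X]oppr0 -[in X in _ --> X](mul0r p^-1); apply: cvgN.
  by apply: cvgM; [exact: powRN_cvgy|exact: cvg_cst].
- by move=> y cy; have [] := dF y (lt_trans c0 cy).
- by apply: cvg_at_right_filter; exact: is_derive_continuous (dF c c0).
- move=> y; rewrite in_itv/= andbT => cy; rewrite derive1E.
  by have [] := dF y (lt_trans c0 cy).
Qed.

(* The integral runs over [4, +oo[ rather than over ]0, 1/4] so that the integrand is
   continuous up to the finite end point. *)
Lemma integral_1Bexp_div y :
  0 < y ->
  (\int[mu]_(v in `[4%R, +oo[) (y ^+ 2 * v `^ (-2) * expR (- (v `^ (-1) * y ^+ 2)))%:E =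
   (1 - expR (- (y ^+ 2 / 4)))%:E)%E.
Proof.
move=> y0.
have dF v : 0 < v -> is_derive v 1 (fun v => expR (- (v `^ (-1) * y ^+ 2)))
   (y ^+ 2 * v `^ (-2) * expR (- (v `^ (-1) * y ^+ 2))).
  move=> v0; derive_eq; first by derivef.
  by rewrite (_ : -1 - 1 = -2) /=; ring.
rewrite (@ge0_continuous_FTC2y _ _ (fun v => expR (- (v `^ (-1) * y ^+ 2))) 4 1).
- by rewrite -EFinB powR_inv1// [4^-1 * _]mulrC.
- by move=> v _; rewrite !mulr_ge0 ?powR_ge0 ?expR_ge0 ?exprn_ge0// ltW.
- apply: continuous_in_subspaceT => v; rewrite inE/= in_itv/= andbT => v4.
  have v0 : 0 < v by apply: lt_le_trans v4.
  by notypeclasses refine (is_derive_continuous _); derivef.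
- have h : - (v `^ (-1) * y ^+ 2) @[v --> +oo%R] --> (0 : R).
    rewrite -[in X in _ --> X]oppr0 -[in X in _ --> X](mul0r (y ^+ 2)); apply: cvgN.
    by apply: cvgM; [exact: powRN_cvgy|exact: cvg_cst].
  rewrite -[in X in _ --> X](@expR0 R); apply: (cvg_comp _ _ h); exact: continuous_expR.
- by move=> v v4; have [] := dF v (lt_trans _ v4).
- by apply: cvg_at_right_filter; exact: is_derive_continuous (dF 4 _).
- move=> v; rewrite in_itv/= andbT => v4; rewrite derive1E.
  by have [] := dF v (lt_trans _ v4).
Qed.

Lemma subr_cos_ge0 (z : R) : 0 <= 1 - cos z.
Proof. by rewrite subr_ge0 cos_le1. Qed.

Lemma continuous_1Bcos_powR p y : 0 < y ->
  {for y, continuous (fun y => 2 * (1 - cos y) * y `^ p)}.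
Proof. by move=> y0; notypeclasses refine (is_derive_continuous _); derivef. Qed.

(** The weight y^(-1-alpha) dy is homogeneous of degree -alpha. The identity is in the extended
    reals because finiteness is known only after [integral_1Bcos_powR1], whose proof uses this
    scaling. *)
Lemma integral_1Bcos_scale (alpha t : R) : 0 < t ->
  (\int[mu]_(y in `]0%R, +oo[) (2 * (1 - cos (t * y)) * y `^ (-1 - alpha))%:E =
   (t `^ alpha)%:E * \int[mu]_(y in `]0%R, +oo[) (2 * (1 - cos y) * y `^ (-1 - alpha))%:E)%E.
Proof.
move=> t0; pose G y := 2 * (1 - cos y) * y `^ (-1 - alpha).
have G0 (y : R) : 0 < y -> 0 <= G y by move=> _; rewrite !mulr_ge0 ?powR_ge0 ?subr_cos_ge0.
have cG (y : R) : 0 < y -> {for y, continuous G} by exact: continuous_1Bcos_powR.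
rewrite (integral_scale t0 cG G0) -ge0_integralZl_EFin ?powR_ge0//.
- apply: eq_integral => y; rewrite inE/= in_itv/= andbT => y0; rewrite -EFinM /G.
  rewrite powRM ?(ltW t0) ?(ltW y0)// [t `^ (_ - _)]powRB ?(gt_eqF t0) ?implybT// powR_inv1 ?(ltW t0)//.
  congr (_%:E); have : t `^ alpha != 0 by rewrite gt_eqF// powR_gt0.
  move: (t `^ alpha) (cos _) (y `^ _) => w a b w0; field.
  by rewrite w0 gt_eqF.
- by move=> y /=; rewrite in_itv/= andbT => y0; rewrite lee_fin mulr_ge0 ?(ltW t0) ?G0// mulr_gt0.
- apply/measurable_EFinP; apply: continuous_measurable_gt0 => y y0.
  have ty0 : 0 < t * y by rewrite mulr_gt0.
  by notypeclasses refine (is_derive_continuous _); rewrite /G; derivef.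
Qed.

End GaussianIntegrals.

(** * Evaluation of the normalising constant *)

Section FractionalLaplacianConstant.
Context {R : realType}.
Notation mu := (@lebesgue_measure R).
Implicit Types alpha p : R.

(** By [integral_1Bexp_div], 1 - exp(-y^2/4) is an integral over v. After Tonelli the integral over
    y is a Gaussian moment with u = 1/v, finite because alpha < 2; what remains is v^(-1 - alpha/2),
    integrable because alpha > 0. The end point 4 produces 4^(-alpha/2) = 2^(-alpha). *)
Lemma integral_1Bexp_powR alpha : 0 < alpha -> alpha < 2 ->
  (\int[mu]_(y in `]0%R, +oo[) (y `^ (-1 - alpha) * (1 - expR (- (y ^+ 2 / 4))))%:E =
   (Gamma (1 - alpha / 2) * 2 `^ (- alpha) / alpha)%:E)%E.
Proof.
move=> alpha_gt0 alpha_lt2.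
have mP : measurable (`]0, +oo[%classic : set R) by exact: measurable_itv.
have I4 : measurable (`[4, +oo[%classic : set R) by exact: measurable_itv.
have a1 : 0 < 1 - alpha + 1 by lra.
have a2 : 0 < alpha / 2 by lra.
pose f (z : R * R) : \bar R :=
  (z.1 `^ (1 - alpha) * z.2 `^ (-2) * expR (- (z.2 `^ (-1) * z.1 ^+ 2)))%:E.
transitivity (\int[mu]_(y in `]0%R, +oo[) \int[mu]_(v in `[4%R, +oo[) f (y, v))%E.
  apply: eq_integral => y; rewrite inE/= in_itv/= andbT => y0.
  rewrite EFinM -(integral_1Bexp_div y0) -ge0_integralZl_EFin ?powR_ge0//.
  - apply: eq_integral => v _; rewrite -EFinM /f/=.
    have -> : y `^ (1 - alpha) = y `^ (-1 - alpha) * y ^+ 2.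
      rewrite -powR_mulrn ?(ltW y0)// -powRD ?(gt_eqF y0) ?implybT//.
      by congr (_ `^ _); ring.
    by rewrite !mulrA.
  - by move=> v _; rewrite lee_fin !mulr_ge0 ?powR_ge0 ?expR_ge0 ?exprn_ge0// ltW.
  - apply/measurable_EFinP; apply: measurable_funTS.
    apply: measurable_funM; first by apply: measurable_funM => //; exact: measurable_powR.
    apply: measurableT_comp => //; apply: measurableT_comp => //.
    by apply: measurable_funM => //; exact: measurable_powR.
rewrite (tonelli_setX mP I4).
- transitivity (\int[mu]_(v in `[4%R, +oo[)
     ((Gamma (1 - alpha / 2) / 2)%:E * (v `^ (-1 - alpha / 2))%:E))%E.
    apply: eq_integral => v; rewrite inE/= in_itv/= andbT => v4.
    have v0 : 0 < v by apply: lt_le_trans v4.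
    transitivity (\int[mu]_(y in `]0%R, +oo[) ((v `^ (-2))%:E *
       (y `^ (1 - alpha) * expR (- (v `^ (-1) * y ^+ 2)))%:E))%E.
      by apply: eq_integral => y _; rewrite /f/= -EFinM; congr (_%:E); ring.
    rewrite ge0_integralZl_EFin ?powR_ge0//.
    + rewrite integral_powR_gauss ?powR_gt0// -!EFinM; congr (_%:E).
      rewrite -powRrM (_ : (1 - alpha + 1) / 2 = 1 - alpha / 2); last by field.
      rewrite mulrCA -powRD ?(gt_eqF v0) ?implybT//.
      by congr (_ * _ `^ _); ring.
    + by move=> y _; rewrite lee_fin mulr_ge0 ?powR_ge0 ?expR_ge0.
    + apply/measurable_EFinP; apply: measurable_funTS; apply: measurable_funM.
        exact: measurable_powR.
      by apply: measurableT_comp => //; apply: measurableT_comp => //; exact: measurable_funM.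
  have G0 : 0 <= Gamma (1 - alpha / 2).
    by apply: Rintegral_ge0 => t _; rewrite mulr_ge0 ?powR_ge0 ?expR_ge0.
  rewrite ge0_integralZl_EFin ?divr_ge0//.
  + rewrite integral_powRN_tail// -EFinM; congr (_%:E).
    rewrite (_ : 4 = 2 `^ 2) -?powRrM; last by rewrite powR_mulrn//; ring.
    rewrite (_ : 2 * - (alpha / 2) = - alpha); last by field.
    by field; rewrite gt_eqF.
  + by move=> v _; rewrite lee_fin powR_ge0.
  + by apply/measurable_EFinP; apply: measurable_funTS; exact: measurable_powR.
- apply/measurable_EFinP; apply: measurable_funM.
    apply: measurable_funM.
      by apply: (measurableT_comp (measurable_powR _)).
    by apply: (measurableT_comp (measurable_powR _)).
  apply: measurableT_comp => //; apply: measurableT_comp => //; apply: measurable_funM.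
    by apply: (measurableT_comp (measurable_powR _)).
  exact: measurable_funX.
- by move=> y v _ _; rewrite lee_fin !mulr_ge0 ?powR_ge0 ?expR_ge0.
Qed.

Lemma Gamma_gt0 p : 0 < p -> 0 < Gamma p.
Proof.
move=> p0; rewrite -lte_fin -integral_gamma//.
have mf (D : set R) : measurable_fun D (fun t => (t `^ (p - 1) * expR (- t))%:E).
  apply/measurable_EFinP; apply: measurable_funTS; apply: measurable_funM.
    exact: measurable_powR.
  by apply: measurableT_comp.
have I12 : measurable (`[1, 2]%classic : set R) by exact: measurable_itv.
(* On [1, 2] one has t^(p-1) = t^p / t >= 1/2, as t^p >= 1 and t <= 2, while exp(-t) >= exp(-2). *)
apply: (@lt_le_trans _ _ (\int[mu]_(t in `[1%R, 2%R]) (2^-1 * expR (- 2))%:E)%E).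
  rewrite integral_cst//= lebesgue_measure_itv/= lte_fin ltr1n -EFinB -EFinM lte_fin.
  by rewrite !mulr_gt0 ?expR_gt0// subr_gt0 ltr1n.
apply: (@le_trans _ _ (\int[mu]_(t in `[1%R, 2%R]) (t `^ (p - 1) * expR (- t))%:E)%E).
  apply: ge0_le_integral => //.
  - exact: mf.
  - move=> t /=; rewrite in_itv/= => /andP[t1 t2]; rewrite lee_fin.
    have t0 : 0 < t by exact: lt_le_trans t1.
    apply: ler_pM; rewrite ?expR_ge0 ?ler_expR ?lerN2//.
    rewrite powRB ?(gt_eqF t0) ?implybT// powRr1 ?(ltW t0)// ler_pdivlMr//.
    apply: (@le_trans _ _ 1); first by rewrite ler_pdivrMl// mulr1.
    by rewrite -[leLHS](@powRr0 _ t) ler_powR// ltW.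
apply: ge0_subset_integral => //; first exact: mf.
- by move=> t _; rewrite lee_fin mulr_ge0 ?powR_ge0 ?expR_ge0.
- by move=> t /=; rewrite !in_itv/= andbT => /andP[t1 _]; exact: lt_le_trans t1.
Qed.

Lemma frac_laplacian_const_gt0 alpha : 0 < alpha -> alpha < 2 ->
  0 < frac_laplacian_const alpha.
Proof.
move=> a0 a2; rewrite /frac_laplacian_const mulr_gt0// divr_gt0// mulr_gt0 ?powR_gt0//.
- by apply: Gamma_gt0; rewrite addr_gt0 ?divr_gt0.
- by rewrite sqrtr_gt0 pi_gt0.
- by apply: Gamma_gt0; rewrite subr_gt0 ltr_pdivrMr// mul1r.
Qed.

Lemma integral_1Bcos_powR1 alpha : 0 < alpha -> alpha < 2 ->
  (\int[mu]_(y in `]0%R, +oo[) (2 * (1 - cos y) * y `^ (-1 - alpha))%:E =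
   ((frac_laplacian_const alpha)^-1)%:E)%E.
Proof.
move=> a0 a2; set K := LHS.
have mP : measurable (`]0, +oo[%classic : set R) by exact: measurable_itv.
have K0 : (0 <= K)%E.
  by apply: integral_ge0 => y _; rewrite lee_fin !mulr_ge0 ?powR_ge0 ?subr_cos_ge0.
have a1 : 0 < alpha + 1 by rewrite addr_gt0.
(* over y first, [f] integrates to K times a Gamma value; over t first, to the integral of
   [integral_1Bexp_powR] *)
pose f (z : R * R) : \bar R :=
  (expR (- z.1 ^+ 2) * (2 * (1 - cos (z.1 * z.2)) * z.2 `^ (-1 - alpha)))%:E.
have mf : measurable_fun setT f.
  apply/measurable_EFinP; apply: measurable_funM.
    apply: measurableT_comp => //; apply: measurableT_comp => //.
    exact: measurable_funX.
  apply: measurable_funM; last by apply: (measurableT_comp (measurable_powR _)).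
  apply: measurable_funM => //; apply: measurable_funB => //.
  apply: (measurableT_comp (continuous_measurable_fun (@continuous_cos R))).
  exact: measurable_funM.
have e1 : (\int[mu]_(t in `]0%R, +oo[) \int[mu]_(y in `]0%R, +oo[) f (t, y) =
    K * (Gamma ((alpha + 1) / 2) / 2)%:E)%E.
  (* By homogeneity the inner integral is K t^alpha exp(-t^2); the factor 1 in the exponent lets
     [integral_powR_gauss] apply with u = 1. *)
  transitivity (\int[mu]_(t in `]0%R, +oo[) (K * (t `^ alpha * expR (- (1 * t ^+ 2)))%:E))%E.
    apply: eq_integral => t; rewrite inE/= in_itv/= andbT => t0.
    rewrite mul1r mulrC EFinM muleCA (muleC K) -integral_1Bcos_scale//.
    rewrite -ge0_integralZl_EFin ?expR_ge0//.
    - by move=> y _; rewrite lee_fin !mulr_ge0 ?powR_ge0 ?subr_cos_ge0.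
    - apply/measurable_EFinP; apply: measurable_funTS; apply: measurable_funM.
        apply: measurable_funM => //; apply: measurable_funB => //.
        apply: (measurableT_comp (continuous_measurable_fun (@continuous_cos R))).
        exact: measurable_funM.
      exact: measurable_powR.
  rewrite ge0_integralZl//.
  - by rewrite integral_powR_gauss// powR1 mulr1.
  - apply/measurable_EFinP; apply: measurable_funTS; apply: measurable_funM.
      exact: measurable_powR.
    apply: measurableT_comp => //; apply: measurableT_comp => //.
    by apply: measurable_funM => //; exact: measurable_funX.
  - by move=> t _; rewrite lee_fin mulr_ge0 ?powR_ge0 ?expR_ge0.
have e2 : (\int[mu]_(y in `]0%R, +oo[) \int[mu]_(t in `]0%R, +oo[) f (t, y) =
    (Num.sqrt pi * (Gamma (1 - alpha / 2) * 2 `^ (- alpha) / alpha))%:E)%E.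
  rewrite EFinM -integral_1Bexp_powR// -ge0_integralZl_EFin ?sqrtr_ge0//.
  - apply: eq_integral => y; rewrite inE/= in_itv/= andbT => y0.
    transitivity (\int[mu]_(t in `]0%R, +oo[)
        ((2 * y `^ (-1 - alpha))%:E * (expR (- t ^+ 2) * (1 - cos (t * y)))%:E))%E.
      by apply: eq_integral => t _; rewrite /f/= -EFinM; congr (_%:E); ring.
    rewrite ge0_integralZl_EFin ?mulr_ge0 ?powR_ge0//.
    + rewrite integral_gauss_1Bcos -!EFinM; congr (_%:E).
      by move: (y `^ _) (expR _) (Num.sqrt _) => a b c; field.
    + apply/measurable_EFinP; apply: measurable_funTS; apply: measurable_funM.
        exact: measurable_gauss_fun.
      apply: measurable_funB => //.
      apply: (measurableT_comp (continuous_measurable_fun (@continuous_cos R))).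
      exact: measurable_funM.
  - move=> y _; rewrite lee_fin mulr_ge0 ?powR_ge0// subr_ge0 -[leRHS]expR0 ler_expR.
    by rewrite oppr_le0 divr_ge0 ?sqr_ge0.
  - apply/measurable_EFinP; apply: measurable_funTS; apply: measurable_funM.
      exact: measurable_powR.
    apply: measurable_funB => //; apply: measurableT_comp => //; apply: measurableT_comp => //.
    by apply: measurable_funM => //; exact: measurable_funX.
have := tonelli_setX mP mP mf.
move=> /(_ (fun t y _ _ => _)) => h.
have {h} : (K * (Gamma ((alpha + 1) / 2) / 2)%:E =
    (Num.sqrt pi * (Gamma (1 - alpha / 2) * 2 `^ (- alpha) / alpha))%:E)%E.
  rewrite -e1 -e2; apply: h => t y.
  by rewrite lee_fin !mulr_ge0 ?expR_ge0 ?powR_ge0 ?subr_cos_ge0.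
have G1 : 0 < Gamma ((alpha + 1) / 2) by apply: Gamma_gt0; rewrite divr_gt0.
have G2 : 0 < Gamma (1 - alpha / 2).
  by apply: Gamma_gt0; rewrite subr_gt0 ltr_pdivrMr// mul1r.
have sp : 0 < Num.sqrt (pi : R) by rewrite sqrtr_gt0 pi_gt0.
(* So far K is only known to lie in [0, +oo]. Its product with a positive Gamma value is finite,
   which excludes +oo: convergence comes out of the computation. *)
clear e1 e2; case: K K0 => [k _ | _ |//]; last first.
  by rewrite gt0_mulye// lte_fin divr_gt0.
rewrite -EFinM => -[kE]; congr (_%:E).
have -> : k = Num.sqrt pi * (Gamma (1 - alpha / 2) * 2 `^ (- alpha) / alpha) /
    (Gamma ((alpha + 1) / 2) / 2).
  by rewrite -kE mulfK// gt_eqF// divr_gt0.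
rewrite /frac_laplacian_const (_ : 1 / 2 + alpha / 2 = (alpha + 1) / 2); last by field.
rewrite powRN powRB ?powRr1// ?pnatr_eq0 ?implybT//.
have w0 : 0 < (2 : R) `^ alpha by exact: powR_gt0.
move: (Num.sqrt pi) (Gamma _) (Gamma _) (2 `^ alpha) sp G1 G2 w0 => s g1 g2 w s0 g10 g20 w0.
by field; rewrite !gt_eqF.
Qed.

Lemma integral_1Bcos_powR alpha (t : R) : 0 < alpha -> alpha < 2 -> 0 < t ->
  (\int[mu]_(y in `]0%R, +oo[) (2 * (1 - cos (t * y)) * y `^ (-1 - alpha))%:E =
   (t `^ alpha / frac_laplacian_const alpha)%:E)%E.
Proof. by move=> a0 a2 t0; rewrite integral_1Bcos_scale// integral_1Bcos_powR1. Qed.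

End FractionalLaplacianConstant.

(** * Second differences of a Fourier integral with a real kernel *)

Section FourierIntegral.
Context {R : realType}.
Notation mu := (@lebesgue_measure R).
Context (alpha : R) (m T : R -> R).
Context (alpha_gt0 : 0 < alpha) (alpha_lt2 : alpha < 2).
Context (mm : measurable_fun setT m).
Context (Im : mu.-integrable `]0, +oo[ (EFin \o m)).
Context (Ima : mu.-integrable `]0, +oo[ (EFin \o (fun t => m t * t `^ alpha))).
Context (cT : continuous T) (T_le1 : forall z, `|T z| <= 1).
Context (T_cos : forall a b, T (a + b) + T (a - b) = 2 * T a * cos b).

Let u (z : R) : R := \int[mu]_(t in `]0, +oo[) (m t * T (t * z)).
Let h (x y : R) : R := (2 * u x - u (x + y) - u (x - y)) * y `^ (-1 - alpha).

Let mP : measurable (`]0, +oo[%classic : set R).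
Proof. exact: measurable_itv. Qed.

Let integrable_mT z : mu.-integrable `]0, +oo[ (EFin \o (fun t => m t * T (t * z))).
Proof.
apply: integrableM_le1 => //; apply: measurable_funTS; apply: continuous_measurable_fun.
exact: continuous_mulr_comp.
Qed.

(** [T_cos] at the pair (tx, ty) separates the variables: x stays in m(t) T(tx), and y enters only
    through the nonnegative weight of [integral_1Bcos_powR]. *)
Let second_difference x y :
  h x y = \int[mu]_(t in `]0, +oo[) (m t * T (t * x) * (2 * (1 - cos (t * y)) * y `^ (-1 - alpha))).
Proof.
have I2 : mu.-integrable `]0, +oo[ (EFin \o (fun t => 2 * (m t * T (t * x)))).
  exact: (@integrableZl _ _ _ mu _ mP 2 _ (integrable_mT x)).
have I1 : mu.-integrable `]0, +oo[
    (EFin \o (fun t => 2 * (m t * T (t * x)) - m t * T (t * (x + y)))).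
  exact: (@integrableB _ _ _ mu _ mP _ _ I2 (integrable_mT (x + y))).
have I0 : mu.-integrable `]0, +oo[
    (EFin \o (fun t => 2 * (m t * T (t * x)) - m t * T (t * (x + y)) - m t * T (t * (x - y)))).
  exact: (@integrableB _ _ _ mu _ mP _ _ I1 (integrable_mT (x - y))).
rewrite /h /u -RintegralZl// -RintegralB// -RintegralB// -RintegralZr//.
apply: eq_Rintegral => t _; rewrite !mulrA; congr (_ * _).
have := T_cos (t * x) (t * y); rewrite -mulrBr -mulrDr.
by move: (T _) (T _) (T _) (cos _) (m t) => a b c d e abc; rewrite -addrA -opprD -mulrDr abc; ring.
Qed.

(** Halving keeps the last factor within the bound 1 that [integrableM_le1] asks for;
    [integrable_mT_factor] then multiplies by 4 y^(-1-alpha). *)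
Let integrable_mT_1Bcos x y : mu.-integrable `]0, +oo[
  (EFin \o (fun t => m t * T (t * x) * ((1 - cos (t * y)) / 2))).
Proof.
apply: integrableM_le1 => //.
  apply: measurable_funTS; apply: measurable_funM => //; apply: measurable_funB => //.
  by apply: (measurableT_comp (continuous_measurable_fun (@continuous_cos R))); exact: measurable_funM.
move=> t; have := cos_le1 (t * y); have := cos_geN1 (t * y).
by rewrite ler_norml => c1 c2; lra.
Qed.

Let integrable_mT_factor x y : mu.-integrable `]0, +oo[
  (EFin \o (fun t => m t * T (t * x) * (2 * (1 - cos (t * y)) * y `^ (-1 - alpha)))).
Proof.
have := @integrableZr _ _ _ mu _ mP (4 * y `^ (-1 - alpha)) _ (integrable_mT_1Bcos x y).
apply: eq_integrable => // t _ /=; rewrite -EFinM; congr (_%:E).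
by move: (m t * _) (cos _) (y `^ _) => a b w; field.
Qed.

(** Fubini, with [integral_1Bcos_powR] for the integral over y. As that weight is nonnegative, the
    same formula turns the absolute double integral into the integral of |m(t) t^alpha T(tx)| / c,
    finite by [Ima]. *)
Lemma integrable_second_difference x :
  mu.-integrable `]0, +oo[ (EFin \o h x) /\
  \int[mu]_(y in `]0, +oo[) h x y =
  (\int[mu]_(t in `]0, +oo[) (m t * t `^ alpha * T (t * x))) / frac_laplacian_const alpha.
Proof.
pose c := frac_laplacian_const alpha.
pose G (t y : R) : R := 2 * (1 - cos (t * y)) * y `^ (-1 - alpha).
have G0 t y : 0 <= G t y by rewrite !mulr_ge0 ?powR_ge0 ?subr_cos_ge0.
pose f (z : R * R) : \bar R := (m z.2 * T (z.2 * x) * G z.2 z.1)%:E.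
have mT (z : R) : measurable_fun setT (fun t : R => T (t * z)).
  by apply: continuous_measurable_fun; exact: continuous_mulr_comp.
have mG : measurable_fun setT (fun z : R * R => G z.2 z.1).
  apply: measurable_funM; last by apply: (measurableT_comp (measurable_powR _)).
  apply: measurable_funM => //; apply: measurable_funB => //.
  apply: (measurableT_comp (continuous_measurable_fun (@continuous_cos R))).
  exact: measurable_funM.
have mf : measurable_fun setT f.
  apply/measurable_EFinP; apply: measurable_funM => //.
  by apply: measurable_funM; [exact: measurableT_comp|exact: (measurableT_comp (mT x))].
have IG t : 0 < t -> mu.-integrable `]0, +oo[ (EFin \o G t).
  move=> t0; apply/integrableP; split.
    apply/measurable_EFinP; apply: continuous_measurable_gt0 => y y0.
    by notypeclasses refine (is_derive_continuous _); rewrite /G; derivef.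
  under eq_integral do rewrite /= ger0_norm//.
  by rewrite integral_1Bcos_powR// ltry.
have int_f t : 0 < t -> (\int[mu]_(y in `]0%R, +oo[) f (y, t) =
    (m t * T (t * x) * (t `^ alpha / c))%:E)%E.
  move=> t0; under eq_integral do rewrite /f/= EFinM.
  by rewrite integralZl//; [rewrite integral_1Bcos_powR|exact: IG].
have int_absf t : 0 < t -> (\int[mu]_(y in `]0%R, +oo[) `|f (y, t)| =
    (`|m t * t `^ alpha * T (t * x)| / c)%:E)%E.
  move=> t0; under eq_integral do rewrite /f/= normrM [X in _ * X]ger0_norm ?G0// EFinM.
  rewrite integralZl//; last exact: IG.
  rewrite integral_1Bcos_powR// -EFinM; congr (_%:E).
  by rewrite !normrM (ger0_norm (powR_ge0 _ _)) mulrA; congr (_ / _); rewrite mulrAC.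
have Im1 : mu.-integrable `]0, +oo[ (EFin \o (fun t => m t * t `^ alpha * T (t * x))).
  by apply: integrableM_le1 => //; exact: measurable_funTS.
have Im2 : mu.-integrable `]0, +oo[ (EFin \o (fun t => `|m t * t `^ alpha * T (t * x)| / c)).
  exact: (@integrableZr _ _ _ mu _ mP c^-1 _ (integrable_norm Im1)).
have fin : (\int[mu]_(t in `]0%R, +oo[) \int[mu]_(y in `]0%R, +oo[) `|f (y, t)| < +oo)%E.
  rewrite (_ : (\int[mu]_(t in `]0%R, +oo[) _)%E =
    (\int[mu]_(t in `]0%R, +oo[) (`|m t * t `^ alpha * T (t * x)| / c)%:E)%E).
    exact: integrable_lty Im2.
  by apply: eq_integral => t; rewrite inE/= in_itv/= andbT => t0; exact: int_absf.
have [If swap] := fubini_setX mP mP mf fin.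
have hE y : (h x y)%:E = (\int[mu]_(t in `]0%R, +oo[) f (y, t))%E.
  rewrite second_difference /Rintegral fineK; first by [].
  by apply: integrable_fin_num; first [exact: mP|exact: (integrable_mT_factor x y)].
split.
  rewrite (_ : EFin \o h x = fun y => (\int[mu]_(t in `]0%R, +oo[) f (y, t))%E); first exact: If.
  by apply/funext => y; exact: hE.
have -> : \int[mu]_(y in `]0, +oo[) h x y =
    fine (\int[mu]_(y in `]0%R, +oo[) \int[mu]_(t in `]0%R, +oo[) f (y, t))%E.
  by rewrite /Rintegral; congr fine; apply: eq_integral => y _; exact: hE.
rewrite swap -RintegralZr; [|exact: mP|exact: Im1].
rewrite /Rintegral; congr fine; apply: eq_integral => t; rewrite inE/= in_itv/= andbT => t0.
rewrite (int_f t t0) -/c; clear -c.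
by rewrite mulrA [m t * T _ * _]mulrAC.
Qed.

End FourierIntegral.

(** * Reduction of the principal value to an absolutely convergent integral *)

Section PrincipalValue.
Context {R : realType}.
Notation mu := (@lebesgue_measure R).
Implicit Types (G u : R -> R) (a x p M alpha : R).

(** Reflection for a signed integrand: it is made on [-(a + n), -a], and both sides converge by
    exhaustion. *)
Lemma Rintegral_itvNy_oppr G a : (forall y : R, y <= - a -> {for y, continuous G}) ->
  mu.-integrable `]-oo, - a] (EFin \o G) ->
  mu.-integrable `[a, +oo[ (EFin \o (fun y => G (- y))) ->
  \int[mu]_(y in `]-oo, - a]) G y = \int[mu]_(y in `[a, +oo[) G (- y).
Proof.
move=> cG I1 I2.
have c1 : (\int[mu]_(y in `[- (a + n%:R), - a]) G y) @[n --> \oo] -->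
    \int[mu]_(y in `]-oo, - a]) G y.
  apply: cvg_Rintegral_exhaustion => //.
  - by move=> n y /=; rewrite !in_itv/= => /andP[].
  - move=> y /=; rewrite in_itv/= => ya; near=> n.
    have nB : - y - a <= n%:R by near: n; exact: nbhs_infty_ger.
    by rewrite /= in_itv/= ya andbT; lra.
have c2 : (\int[mu]_(y in `[a, a + n%:R]) G (- y)) @[n --> \oo] -->
    \int[mu]_(y in `[a, +oo[) G (- y).
  apply: cvg_Rintegral_exhaustion => //.
  - by move=> n y /=; rewrite !in_itv/= => /andP[-> _].
  - move=> y /=; rewrite in_itv/= andbT => ya; near=> n.
    have nB : y - a <= n%:R by near: n; exact: nbhs_infty_ger.
    by rewrite /= in_itv/= ya/=; lra.
apply: (cvg_unique _ c1) => //=; move: c2; under eq_cvg => n.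
  rewrite /Rintegral -(@integration_by_substitution_oppr _ G); last 2 first.
    by rewrite lerDl.
    apply: continuous_in_subspaceT => y; rewrite inE/= in_itv/= => /andP[_ ya].
    exact: cG.
  over.
by [].
Unshelve. all: by end_near. Qed.

Lemma integrable_powRN_tail a p : 0 < a -> 0 < p ->
  mu.-integrable `[a, +oo[ (EFin \o (fun y => y `^ (-1 - p))).
Proof.
move=> a0 p0; apply/integrableP; split.
  by apply/measurable_EFinP; apply: measurable_funTS; exact: measurable_powR.
under eq_integral do rewrite /= ger0_norm ?powR_ge0//.
by rewrite integral_powRN_tail// ltry.
Qed.

Lemma integrable_powRN_tail_opp a p : 0 < a -> 0 < p ->
  mu.-integrable `]-oo, - a] (EFin \o (fun y => (- y) `^ (-1 - p))).
Proof.
move=> a0 p0; apply/integrableP; split.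
  apply/measurable_EFinP; apply: measurable_funTS.
  by apply: (measurableT_comp (measurable_powR _)).
under eq_integral do rewrite /= ger0_norm ?powR_ge0//.
rewrite ge0_integration_by_substitutionNy//.
- under eq_integral do rewrite /= opprK.
  by rewrite integral_powRN_tail// ltry.
- apply: continuous_in_subspaceT => y; rewrite inE/= in_itv/= => ya.
  have y0 : 0 < - y by lra.
  by notypeclasses refine (is_derive_continuous _); derivef.
- by move=> y _; exact: powR_ge0.
Qed.

(** Away from 0 the bound [M] gives the majorant 2 M |y|^(-1-alpha), so every truncated integral
    exists. Reflecting the negative half makes it the integral of the second difference over y >
    eps, and the assumed integrability down to 0 provides the limit. *)
Lemma pv_second_difference alpha u x M : 0 < alpha -> continuous u ->
  (forall z, `|u z| <= M) ->
  mu.-integrable `]0, +oo[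
    (EFin \o (fun y => (2 * u x - u (x + y) - u (x - y)) * y `^ (-1 - alpha))) ->
  (forall eps : R, 0 < eps -> mu.-integrable [set y | eps < `|y|]
     (EFin \o (fun y => (u x - u (x + y)) / `|y| `^ (1 + alpha)))) /\
  (\int[mu]_(y in [set y | eps < `|y|]) ((u x - u (x + y)) / `|y| `^ (1 + alpha)))
     @[eps --> 0^'+] -->
  \int[mu]_(y in `]0, +oo[) ((2 * u x - u (x + y) - u (x - y)) * y `^ (-1 - alpha)).
Proof.
move=> a0 cu uM; set h := fun y => _ * _ => Ih.
pose g y := (u x - u (x + y)) / `|y| `^ (1 + alpha).
have M0 : 0 <= M by apply: le_trans (uM 0).
have bnd y : `|u x - u y| <= 2 * M.
  by apply: (le_trans (ler_normB _ _)); rewrite mulr_natl mulr2n lerD.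
have cxu : continuous (fun y : R => u (x + y)).
  move=> y; apply: (@continuous_comp _ _ _ (fun y => x + y) u); last exact: cu.
  by apply: continuousD; [exact: cst_continuous|exact: id].
have mg : measurable_fun setT g.
  apply: measurable_funM.
    by apply: measurable_funB => //; exact: continuous_measurable_fun.
  rewrite (_ : (fun y => _) = (fun y => `|y| `^ (- (1 + alpha)))); last first.
    by apply/funext => y; rewrite powRN.
  by apply: (measurableT_comp (measurable_powR _)).
have gp y : 0 < y -> g y = (u x - u (x + y)) * y `^ (-1 - alpha).
  by move=> y0; rewrite /g gtr0_norm// -powRN opprD.
(* The form taken by [g] for y < 0, free of the absolute value, so that the continuity of its power
   factor follows from the differentiation rules. *)
pose gn y := (u x - u (x + y)) * (- y) `^ (-1 - alpha).
have gnE y : y < 0 -> g y = gn y.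
  by move=> y0; rewrite /g ltr0_norm// -powRN opprD.
have Ip a : 0 < a -> mu.-integrable `[a, +oo[ (EFin \o g).
  move=> a_gt0.
  have I1 := @integrableZl _ _ _ mu _ (measurable_itv `[a, +oo[) (2 * M) _
    (integrable_powRN_tail a_gt0 a0).
  apply: le_integrable I1 => //.
    by apply/measurable_EFinP; exact: measurable_funTS.
  move=> y /=; rewrite in_itv/= andbT => ay; have y0 := lt_le_trans a_gt0 ay.
  rewrite gp// lee_fin !normrM; apply: ler_pM => //.
  by rewrite -normrM [leRHS]ger0_norm ?mulr_ge0.
have In a : 0 < a -> mu.-integrable `]-oo, - a] (EFin \o g).
  move=> a_gt0.
  have I1 := @integrableZl _ _ _ mu _ (measurable_itv `]-oo, - a]) (2 * M) _
    (integrable_powRN_tail_opp a_gt0 a0).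
  apply: le_integrable I1 => //.
    by apply/measurable_EFinP; exact: measurable_funTS.
  move=> y /=; rewrite in_itv/= => ya; have y0 : y < 0 by lra.
  rewrite gnE// lee_fin !normrM; apply: ler_pM => //.
  by rewrite -normrM [leRHS]ger0_norm ?mulr_ge0.
have setE a : 0 < a -> [set y : R | a < `|y|] = `]-oo, - a[ `|` `]a, +oo[.
  move=> a_gt0; apply/seteqP; split => y /=; rewrite !in_itv/= !andbT ltr_normr.
    by move=> /orP[]; [right|left; rewrite ltrNr].
  by move=> [|]; [rewrite ltrNr => ->; rewrite orbT|move=> ->].
have mNo a : measurable (`]-oo, - a[%classic : set R) by exact: measurable_itv.
have mPo a : measurable (`]a, +oo[%classic : set R) by exact: measurable_itv.
have Ip' a : 0 < a -> mu.-integrable `]a, +oo[ (EFin \o g).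
  move=> a_gt0; apply: integrableS (Ip _ a_gt0) => //.
  by move=> y /=; rewrite !in_itv/= !andbT; exact: ltW.
have In' a : 0 < a -> mu.-integrable `]-oo, - a[ (EFin \o g).
  move=> a_gt0; apply: integrableS (In _ a_gt0) => //.
  by move=> y /=; rewrite !in_itv/=; exact: ltW.
have Iu a : 0 < a -> mu.-integrable [set y | a < `|y|] (EFin \o g).
  move=> a_gt0; rewrite setE//; apply/integrableP; split.
    by apply/measurable_EFinP; exact: measurable_funTS.
  rewrite ge0_integral_setU//=.
  - apply: lte_add_pinfty.
      by have /integrableP[] := In' a a_gt0.
    by have /integrableP[] := Ip' a a_gt0.
  - apply/measurable_EFinP; apply: measurable_funTS.
    exact: (measurableT_comp (@normr_measurable R setT)).
  - apply/disj_setPS => y [] /=; rewrite !in_itv/= andbT => y1 y2; lra.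
have cgn a y : 0 < a -> y <= - a -> {for y, continuous gn}.
  move=> a_gt0 ya; apply: continuousM.
    by apply: continuousB; [exact: cst_continuous|exact: cxu].
  have y0 : 0 < - y by lra.
  by notypeclasses refine (is_derive_continuous _); derivef.
have In_gn a : 0 < a -> mu.-integrable `]-oo, - a] (EFin \o gn).
  move=> a_gt0; apply: eq_integrable (In a a_gt0) => // y.
  by rewrite inE/= in_itv/= => ya; rewrite gnE//; lra.
have Ih' a : 0 < a -> mu.-integrable `[a, +oo[ (EFin \o h).
  move=> a_gt0; apply: integrableS Ih => //.
  by move=> y /=; rewrite !in_itv/= !andbT; exact: lt_le_trans.
have hE y : 0 < y -> h y = gn (- y) + g y.
  by move=> y0; rewrite gp// /gn opprK /h; ring.
(* Obtained as the difference [h - g] of two integrable functions, without a new estimate. *)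
have Iopp a : 0 < a -> mu.-integrable `[a, +oo[ (EFin \o (fun y => gn (- y))).
  move=> a_gt0; have := @integrableB _ _ _ mu _ (measurable_itv `[a, +oo[) _ _ (Ih' a a_gt0) (Ip a a_gt0).
  apply: eq_integrable => // y; rewrite inE/= in_itv/= andbT => ay.
  by rewrite -EFinB hE ?addrK// (lt_le_trans a_gt0 ay).
have intE a : 0 < a -> \int[mu]_(y in [set y | a < `|y|]) g y = \int[mu]_(y in `]a, +oo[) h y.
  move=> a_gt0; rewrite setE// Rintegral_setU//; last 2 first.
  - by rewrite -setE//; exact: Iu.
  - by apply/disj_setPS => y [] /=; rewrite !in_itv/= andbT => y1 y2; lra.
  rewrite Rintegral_itv_bndo_bndc ?In'// Rintegral_itv_obnd_cbnd ?Ip'//.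
  rewrite (_ : \int[mu]_(y in `]-oo, - a]) g y = \int[mu]_(y in `]-oo, - a]) gn y); last first.
    by apply: eq_Rintegral => y; rewrite inE/= in_itv/= => ya; rewrite gnE//; lra.
  rewrite Rintegral_itvNy_oppr//; [|by move=> y; exact: cgn|exact: In_gn|exact: Iopp].
  rewrite -RintegralD//; [|exact: Iopp|exact: Ip].
  rewrite Rintegral_itv_obnd_cbnd; last first.
    by apply: integrableS (Ih' _ a_gt0) => // y /=; rewrite !in_itv/= !andbT; exact: ltW.
  apply: eq_Rintegral => y; rewrite inE/= in_itv/= andbT => ay.
  by rewrite hE// (lt_le_trans a_gt0 ay).
split; first exact: Iu.
(* The one-sided limit is tested along sequences, which brings it under
   [cvg_Rintegral_exhaustion]. *)
apply/cvg_at_rightP => e [e0 e_cvg]; under eq_cvg do rewrite intE//.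
apply: cvg_Rintegral_exhaustion => //.
- by move=> n y /=; rewrite !in_itv/= !andbT; exact: lt_trans.
- move=> y /=; rewrite in_itv/= andbT => y0.
  near=> n; rewrite /= in_itv/= andbT; near: n.
  exact: (cvgr_lt 0).
Unshelve. all: by end_near. Qed.

End PrincipalValue.

(** * The principal value of a Fourier integral plus a constant *)

Section FourierPrincipalValue.
Context {R : realType}.
Notation mu := (@lebesgue_measure R).

(** The constant [c0] cancels in every difference of values of [u]; it accounts for the limit 1 of
    [lambda n] at infinity. The integral of |m| gives the uniform bound on [u] that
    [pv_second_difference] asks for. *)
Lemma pv_Fourier_integral (alpha c0 x : R) (m T : R -> R) :
  0 < alpha -> alpha < 2 -> measurable_fun setT m ->
  mu.-integrable `]0, +oo[ (EFin \o m) ->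
  mu.-integrable `]0, +oo[ (EFin \o (fun t => m t * t `^ alpha)) ->
  continuous T -> (forall z, `|T z| <= 1) ->
  (forall a b, T (a + b) + T (a - b) = 2 * T a * cos b) ->
  forall u : R -> R,
  (forall z, u z = c0 + \int[mu]_(t in `]0, +oo[) (m t * T (t * z))) -> continuous u ->
  (forall eps : R, 0 < eps -> mu.-integrable [set y | eps < `|y|]
     (EFin \o (fun y => (u x - u (x + y)) / `|y| `^ (1 + alpha)))) /\
  (\int[mu]_(y in [set y | eps < `|y|]) ((u x - u (x + y)) / `|y| `^ (1 + alpha)))
     @[eps --> 0^'+] -->
  (\int[mu]_(t in `]0, +oo[) (m t * t `^ alpha * T (t * x))) / frac_laplacian_const alpha.
Proof.
move=> a0 a2 mm Im Ima cT T_le1 T_cos u uE cu.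
have [Ih hE] := integrable_second_difference a0 a2 mm Im Ima cT T_le1 T_cos x.
have uM z : `|u z| <= `|c0| + \int[mu]_(t in `]0, +oo[) `|m t|.
  rewrite uE; apply: (le_trans (ler_normD _ _)); rewrite lerD2l.
  have mP : measurable (`]0, +oo[%classic : set R) by exact: measurable_itv.
  have ImT : mu.-integrable `]0, +oo[ (EFin \o (fun t => m t * T (t * z))).
    apply: integrableM_le1 => //; apply: measurable_funTS; apply: continuous_measurable_fun.
    exact: continuous_mulr_comp.
  apply: (@le_trans _ _ (\int[mu]_(t in `]0, +oo[) `|m t * T (t * z)|)).
    exact: le_normr_Rintegral.
  apply: le_Rintegral => //; [exact: integrable_norm|exact: integrable_norm|].
  by move=> t _; rewrite normrM ler_piMr.
have hu y : (2 * u x - u (x + y) - u (x - y)) * y `^ (-1 - alpha) =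
   (2 * (\int[mu]_(t in `]0, +oo[) (m t * T (t * x))) -
    \int[mu]_(t in `]0, +oo[) (m t * T (t * (x + y))) -
    \int[mu]_(t in `]0, +oo[) (m t * T (t * (x - y)))) * y `^ (-1 - alpha).
  rewrite !uE; congr (_ * _).
  by move: (Rintegral _ _ _) (Rintegral _ _ _) (Rintegral _ _ _) => a b c; ring.
have Ihu : mu.-integrable `]0, +oo[
    (EFin \o (fun y => (2 * u x - u (x + y) - u (x - y)) * y `^ (-1 - alpha))).
  rewrite (_ : (fun y => _) = fun y => (2 * (\int[mu]_(t in `]0, +oo[) (m t * T (t * x))) -
    \int[mu]_(t in `]0, +oo[) (m t * T (t * (x + y))) -
    \int[mu]_(t in `]0, +oo[) (m t * T (t * (x - y)))) * y `^ (-1 - alpha)); first exact: Ih.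
  by apply/funext => y; exact: hu.
have [pv1 pv2] := pv_second_difference a0 cu uM Ihu.
split; first exact: pv1.
rewrite -hE (_ : Rintegral _ _ _ =
  \int[mu]_(y in `]0, +oo[) ((2 * u x - u (x + y) - u (x - y)) * y `^ (-1 - alpha))).
  exact: pv2.
by apply: eq_Rintegral => y _; rewrite hu.
Qed.

End FourierPrincipalValue.

(** * Principal powers of 1 + iv in polar form *)

Section ComplexPowers.
Context {R : realType}.
Implicit Types (p v : R).

Lemma Re_divC (z : R[i]) (r : R) : complex.Re (z / r%:C) = complex.Re z / r.
Proof. by rewrite -fmorphV; case: z => a b /=; rewrite mulr0 subr0. Qed.

Lemma Im_divC (z : R[i]) (r : R) : complex.Im (z / r%:C) = complex.Im z / r.
Proof. by rewrite -fmorphV; case: z => a b /=; rewrite mulr0 add0r. Qed.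

Lemma oneDsqr_gt0 v : 0 < 1 + v ^+ 2.
Proof. by rewrite ltr_pwDl// sqr_ge0. Qed.

Lemma sin_atan v : sin (atan v) = v / Num.sqrt (1 + v ^+ 2).
Proof.
have c0 : cos (atan v) != 0.
  by rewrite gt_eqF// cos_gt0_pihalf// atan_gtNpi2 atan_ltpi2.
by rewrite -cos_atan -[X in X * cos _](atanK v) /tan divfK.
Qed.

(** Since 1 / sqrt(1 + v^2) = cos(atan v), the arccosine returns |atan v|, and the sign test in
    [carg] restores the sign. *)
Lemma carg_1Di v : carg (1 +i* v) = atan v.
Proof.
rewrite /carg /Normc.normc /= expr1n div1r -cos_atan.
have [v0|v0] := leP 0 v.
  rewrite cosK// in_itv/=; have a0 : 0 <= atan v by rewrite -atan0 le_atan.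
  by rewrite a0/= ltW// (lt_le_trans (atan_ltpi2 _))// ler_pdivrMr// ler_peMr ?pi_ge0// ler1n.
rewrite cosKN ?opprK//; have a0 : atan v <= 0 by rewrite -atan0 le_atan// ltW.
rewrite a0 andbT ltW// (le_lt_trans _ (atan_gtNpi2 _))// lerN2.
by rewrite ler_pdivrMr// ler_peMr ?pi_ge0// ler1n.
Qed.

Lemma cpow_1Di v p :
  cpow (1 +i* v) p%:C = ((1 + v ^+ 2) `^ (p / 2) * cos (p * atan v)) +i*
                        ((1 + v ^+ 2) `^ (p / 2) * sin (p * atan v)).
Proof.
have D0 := oneDsqr_gt0 v.
rewrite /cpow /clog carg_1Di /cexp /Normc.normc/= !mul0r subr0 addr0.
rewrite expr1n -powR12_sqrt ?(ltW D0)// ln_powR.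
have -> : expR (p * (2^-1 * ln (1 + v ^+ 2))) = (1 + v ^+ 2) `^ (p / 2).
  by rewrite /powR gt_eqF// mulrA.
by apply/eqP; rewrite eq_complex /= !mul0r subr0 addr0 !eqxx.
Qed.

Lemma cpow_1Di_S v p : cpow (1 +i* v) (p + 1)%:C = cpow (1 +i* v) p%:C * (1 +i* v).
Proof.
have D0 := oneDsqr_gt0 v.
rewrite !cpow_1Di mulrDl powRD ?(gt_eqF D0) ?implybT// mul1r powR12_sqrt ?(ltW D0)//.
rewrite mulrDl mul1r cosD sinD cos_atan sin_atan.
have s0 : Num.sqrt (1 + v ^+ 2) != 0 by rewrite gt_eqF// sqrtr_gt0.
apply/eqP; rewrite eq_complex /=; apply/andP; split; apply/eqP; field; exact: s0.
Qed.

Lemma cpow_1Di_addn v p k : cpow (1 +i* v) (p + k%:R)%:C = cpow (1 +i* v) p%:C * (1 +i* v) ^+ k.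
Proof.
elim: k => [|k IH]; first by rewrite addr0 expr0 mulr1.
by rewrite -natr1 addrA cpow_1Di_S IH exprSr mulrA.
Qed.

Lemma cpow_1Di0 v : cpow (1 +i* v) 0%:C = 1.
Proof.
by rewrite cpow_1Di !mul0r powRr0 cos0 sin0 mulr1 mulr0.
Qed.

Lemma cpow_1Di_natr v k : cpow (1 +i* v) k%:R%:C = (1 +i* v) ^+ k.
Proof. by rewrite -[k%:R]add0r cpow_1Di_addn cpow_1Di0 mul1r. Qed.

(** The angle p atan(v) found in [gamma_cos_sinE] is p times the principal argument of 1 + iv, so
    the real integrals select exactly the branch of [cpow]. *)
Lemma gamma_cpow_1Di p v : 0 < p ->
  gamma_cos p v +i* - gamma_sin p v = (Gamma p)%:C / cpow (1 +i* v) p%:C.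
Proof.
move=> p0; have [-> ->] := gamma_cos_sinE v p0; rewrite cpow_1Di powRN.
set r := (1 + v ^+ 2) `^ (p / 2).
have r0 : r != 0 by rewrite gt_eqF// powR_gt0// oneDsqr_gt0.
set c := cos _; set s := sin _; have cs : c ^+ 2 + s ^+ 2 = 1 by exact: cos2Dsin2.
have z0 : (r * c) +i* (r * s) != 0.
  rewrite eq_complex /= !mulf_eq0 (negbTE r0)/=; apply/negP => /andP[/eqP c0 /eqP s0].
  by move: cs; rewrite c0 s0 expr0n addr0 => /eqP; rewrite eq_sym oner_eq0.
apply: (mulIf z0); rewrite divfK//.
apply/eqP; rewrite eq_complex /=; apply/andP; split; apply/eqP.
  rewrite [RHS](_ : _ = Gamma p * (c ^+ 2 + s ^+ 2)); last by rewrite cs mulr1.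
  by field.
by field.
Qed.

End ComplexPowers.

(** * Fractional Laplacian of a finite sum of negative powers of 1 + isx *)

Section RationalFunctions.
Context {R : realType}.
Notation mu := (@lebesgue_measure R).
Implicit Types (s alpha x z v : R) (p a : nat -> R) (N : nat).

Lemma ReD (y z : R[i]) : complex.Re (y + z) = complex.Re y + complex.Re z.
Proof. by case: y; case: z. Qed.

Lemma ImD (y z : R[i]) : complex.Im (y + z) = complex.Im y + complex.Im z.
Proof. by case: y; case: z. Qed.

Lemma ReB (y z : R[i]) : complex.Re (y - z) = complex.Re y - complex.Re z.
Proof. by case: y; case: z. Qed.

Lemma ImB (y z : R[i]) : complex.Im (y - z) = complex.Im y - complex.Im z.
Proof. by case: y; case: z. Qed.

Lemma sum_complex N a (b c : nat -> R) :
  \sum_(j < N) (a j)%:C * (b j +i* c j) =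
  (\sum_(j < N) a j * b j) +i* (\sum_(j < N) a j * c j).
Proof.
elim: N => [|N IH]; first by rewrite !big_ord0.
rewrite !big_ord_recr /= IH; apply/eqP; rewrite eq_complex /=.
by rewrite !mul0r subr0 addr0 !eqxx.
Qed.

Lemma mulC_divK (c b d : R) : c != 0 -> c%:C * ((b / c) +i* (d / c)) = b +i* d.
Proof.
move=> c0; apply/eqP; rewrite eq_complex /= !mul0r subr0 addr0.
by rewrite ![c * _]mulrC !divfK// !eqxx.
Qed.

(** The Fourier density. Its exponents are a parameter because multiplication by t^alpha merely
    shifts them, as [gamma_sum_powR] shows. *)
Definition gamma_sum p a N (t : R) : R :=
  \sum_(j < N) a j * (t `^ (p j - 1) * expR (- t)).

Lemma measurable_gamma_sum p a N : measurable_fun setT (gamma_sum p a N).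
Proof.
elim: N => [|N IH].
  rewrite (_ : gamma_sum p a 0 = cst 0); first exact: measurable_cst.
  by apply/funext => t; rewrite /gamma_sum big_ord0.
rewrite (_ : gamma_sum p a N.+1 =
    fun t => gamma_sum p a N t + a N * (t `^ (p N - 1) * expR (- t))); last first.
  by apply/funext => t; rewrite /gamma_sum big_ord_recr.
apply: measurable_funD => //; apply: measurable_funM => //; apply: measurable_funM.
  exact: measurable_powR.
by apply: measurableT_comp.
Qed.

Lemma Rintegral_gamma_sum p a N (T : R -> R) v : (forall j, 0 < p j) ->
  continuous T -> (forall z, `|T z| <= 1) ->
  mu.-integrable `]0, +oo[ (EFin \o (fun t => gamma_sum p a N t * T (t * v))) /\
  \int[mu]_(t in `]0, +oo[) (gamma_sum p a N t * T (t * v)) =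
  \sum_(j < N) a j * \int[mu]_(t in `]0, +oo[) (t `^ (p j - 1) * expR (- t) * T (t * v)).
Proof.
move=> p0 cT T_le1.
have mP : measurable (`]0, +oo[%classic : set R) by exact: measurable_itv.
elim: N => [|N [IH1 IH2]].
  rewrite big_ord0 (_ : (fun t => _) = cst 0); last first.
    by apply/funext => t; rewrite /gamma_sum big_ord0 mul0r.
  split; last by rewrite /Rintegral integral0.
  exact: integrable0.
have Ij := integrable_gammaM v (p0 N) cT T_le1.
have IaN : mu.-integrable `]0, +oo[
    (EFin \o (fun t => a N * (t `^ (p N - 1) * expR (- t) * T (t * v)))).
  exact: (@integrableZl _ _ _ mu _ mP (a N) _ Ij).
have sE : (fun t => gamma_sum p a N.+1 t * T (t * v)) =
    fun t => gamma_sum p a N t * T (t * v) + a N * (t `^ (p N - 1) * expR (- t) * T (t * v)).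
  by apply/funext => t; rewrite /gamma_sum big_ord_recr/= mulrDl !mulrA.
rewrite sE; split; first exact: (@integrableD _ _ _ mu _ mP _ _ IH1 IaN).
by rewrite RintegralD// IH2 RintegralZl// big_ord_recr.
Qed.

Lemma integrable_gamma_sum p a N : (forall j, 0 < p j) ->
  mu.-integrable `]0, +oo[ (EFin \o gamma_sum p a N).
Proof.
(* The constant kernel 1 reduces the statement to the integrability of the density itself. *)
move=> p0; have [] := @Rintegral_gamma_sum p a N (cst 1) 0 p0.
- exact: cst_continuous.
- by move=> z; rewrite normr1.
move=> I1 _; rewrite (_ : gamma_sum p a N = fun t => gamma_sum p a N t * cst 1 (t * 0))//.
by apply/funext => t; rewrite mulr1.
Qed.

Lemma gamma_sum_powR p a N alpha (t : R) : 0 < t ->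
  gamma_sum p a N t * t `^ alpha = gamma_sum (fun j => p j + alpha) a N t.
Proof.
move=> t0; rewrite /gamma_sum mulr_suml; apply: eq_bigr => j _.
rewrite -mulrA; congr (_ * _); rewrite mulrAC -powRD ?(gt_eqF t0) ?implybT//.
by congr (_ `^ _ * _); ring.
Qed.

Lemma continuous_sum_comp (f : nat -> R -> R) a N s : (forall j, continuous (f j)) ->
  continuous (fun z => \sum_(j < N) a j * f j (s * z)).
Proof.
move=> cf; elim: N => [|N IH].
  rewrite (_ : (fun z => _) = cst 0); first exact: cst_continuous.
  by apply/funext => z; rewrite big_ord0.
rewrite (_ : (fun z => _) = fun z => \sum_(j < N) a j * f j (s * z) + a N * f N (s * z)).
  move=> z; apply: cvgD; first exact: IH.
  apply: cvgM; first exact: cvg_cst.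
  apply: (@continuous_comp _ _ _ (fun z => s * z) (f N)); last exact: cf.
  by apply: continuousM; [exact: cst_continuous|exact: id].
by apply/funext => z; rewrite big_ord_recr.
Qed.

(** The sign [s] is absorbed into the kernels cos(sz) and -sin(sz); from cos(sb) = cos(b) both
    satisfy the addition law. The factor 1/c left by the principal value cancels
    [frac_laplacian_const]. *)
Lemma frac_laplacian_Fourier s alpha x (L : R -> R[i]) a N : s = 1 \/ s = -1 ->
  0 < alpha -> alpha < 2 ->
  (forall z, L z = 1 + \sum_(j < N) (a j)%:C *
     (gamma_cos j.+1%:R (s * z) +i* - gamma_sin j.+1%:R (s * z))) ->
  frac_laplacian_defined alpha L x /\
  frac_laplacian alpha L x =
    \sum_(j < N) (a j)%:C *
     (gamma_cos (j.+1%:R + alpha) (s * x) +i* - gamma_sin (j.+1%:R + alpha) (s * x)).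
Proof.
move=> s1 a0 a2 LE.
pose p (j : nat) : R := j.+1%:R.
have p0 j : 0 < p j by rewrite /p ltr0Sn.
have pa0 j : 0 < p j + alpha by rewrite addr_gt0.
pose m := gamma_sum p a N.
have Im := integrable_gamma_sum a N p0.
have mP : measurable (`]0, +oo[%classic : set R) by exact: measurable_itv.
have Ima : mu.-integrable `]0, +oo[ (EFin \o (fun t => m t * t `^ alpha)).
  apply: eq_integrable (integrable_gamma_sum a N pa0) => //.
  by move=> t; rewrite inE/= in_itv/= andbT => t0; rewrite gamma_sum_powR.
pose T1 z := cos (s * z); pose T2 z := - sin (s * z).
have csE b : cos (s * b) = cos b.
  by case: s1 => ->; rewrite ?mul1r// mulN1r cosN.
have cT1 : continuous T1.
  by move=> z; notypeclasses refine (is_derive_continuous _); rewrite /T1; derivef.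
have cT2 : continuous T2.
  by move=> z; notypeclasses refine (is_derive_continuous _); rewrite /T2; derivef.
have T1le z : `|T1 z| <= 1 by exact: cos_max.
have T2le z : `|T2 z| <= 1 by rewrite normrN sin_max.
have T1c b c : T1 (b + c) + T1 (b - c) = 2 * T1 b * cos c.
  by rewrite /T1 mulrDr mulrBr cosD cosB !csE; ring.
have T2c b c : T2 (b + c) + T2 (b - c) = 2 * T2 b * cos c.
  by rewrite /T2 mulrDr mulrBr sinD sinB !csE; ring.
have int1 q z : (forall j, 0 < q j) ->
    \int[mu]_(t in `]0, +oo[) (gamma_sum q a N t * T1 (t * z)) =
    \sum_(j < N) a j * gamma_cos (q j) (s * z).
  move=> q0; have [_ ->] := @Rintegral_gamma_sum q a N T1 z q0 cT1 T1le.
  by apply: eq_bigr => j _; congr (_ * _); apply: eq_Rintegral => t _; rewrite /T1 mulrCA.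
have int2 q z : (forall j, 0 < q j) ->
    \int[mu]_(t in `]0, +oo[) (gamma_sum q a N t * T2 (t * z)) =
    \sum_(j < N) a j * - gamma_sin (q j) (s * z).
  move=> q0; have [_ ->] := @Rintegral_gamma_sum q a N T2 z q0 cT2 T2le.
  apply: eq_bigr => j _; congr (_ * _).
  rewrite -[RHS]mulN1r -RintegralZl//; last first.
    exact: (integrable_gammaM (s * z) (q0 j) (@continuous_sin R) (@sin_max R)).
  by apply: eq_Rintegral => t _; rewrite /T2 mulrCA mulN1r mulrN.
have ReL z : complex.Re (L z) = 1 + \sum_(j < N) a j * gamma_cos (p j) (s * z).
  by rewrite LE (sum_complex N a (fun j => gamma_cos j.+1%:R (s * z))
    (fun j => - gamma_sin j.+1%:R (s * z))) ReD.
have ImL z : complex.Im (L z) = 0 + \sum_(j < N) a j * - gamma_sin (p j) (s * z).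
  by rewrite LE (sum_complex N a (fun j => gamma_cos j.+1%:R (s * z))
    (fun j => - gamma_sin j.+1%:R (s * z))) ImD.
have cRe : continuous (fun z => complex.Re (L z)).
  rewrite (_ : (fun z => _) = fun z => 1 + \sum_(j < N) a j * gamma_cos (p j) (s * z)).
    move=> z; apply: cvgD; first exact: cvg_cst.
    apply: (continuous_sum_comp (f := fun j => gamma_cos (p j))) => j y.
    exact: (is_derive_continuous (is_derive_gamma_cos y (p0 j))).
  by apply/funext => z; rewrite ReL.
have cIm : continuous (fun z => complex.Im (L z)).
  rewrite (_ : (fun z => _) = fun z => 0 + \sum_(j < N) a j * - gamma_sin (p j) (s * z)).
    move=> z; apply: cvgD; first exact: cvg_cst.
    apply: (continuous_sum_comp (f := fun j v => - gamma_sin (p j) v)) => j y.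
    apply: cvgN; exact: (is_derive_continuous (is_derive_gamma_sin y (p0 j))).
  by apply/funext => z; rewrite ImL.
have mm : measurable_fun setT m by exact: measurable_gamma_sum.
(* The constants 1 and 0 passed here and below are the real and imaginary parts of the constant term
   of [L]. *)
have [pvr1 pvr2] := @pv_Fourier_integral R alpha 1 x m T1 a0 a2 mm Im Ima cT1 T1le T1c
  (fun z => complex.Re (L z)) (fun z => etrans (ReL z) (congr1 _ (esym (int1 p z p0)))) cRe.
have [pvi1 pvi2] := @pv_Fourier_integral R alpha 0 x m T2 a0 a2 mm Im Ima cT2 T2le T2c
  (fun z => complex.Im (L z)) (fun z => etrans (ImL z) (congr1 _ (esym (int2 p z p0)))) cIm.
have ReI : (fun y => complex.Re (frac_laplacian_integrand alpha L x y)) =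
    fun y => (complex.Re (L x) - complex.Re (L (x + y))) / `|y| `^ (1 + alpha).
  by apply/funext => y; rewrite /frac_laplacian_integrand Re_divC ReB.
have ImI : (fun y => complex.Im (frac_laplacian_integrand alpha L x y)) =
    fun y => (complex.Im (L x) - complex.Im (L (x + y))) / `|y| `^ (1 + alpha).
  by apply/funext => y; rewrite /frac_laplacian_integrand Im_divC ImB.
have c0 := frac_laplacian_const_gt0 a0 a2.
have alphaE T : \int[mu]_(t in `]0, +oo[) (m t * t `^ alpha * T (t * x)) =
    \int[mu]_(t in `]0, +oo[) (gamma_sum (fun j => p j + alpha) a N t * T (t * x)).
  by apply: eq_Rintegral => t; rewrite inE/= in_itv/= andbT => t0; rewrite gamma_sum_powR.
move: pvr2 pvi2; rewrite !alphaE int1// int2// => pvr2 pvi2.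
split.
  split.
    by move=> eps eps0; split; [rewrite ReI; exact: pvr1|rewrite ImI; exact: pvi1].
  split => /=.
    by rewrite ReI; apply: cvgP; exact: pvr2.
  by rewrite ImI; apply: cvgP; exact: pvi2.
rewrite (sum_complex N a (fun j => gamma_cos (j.+1%:R + alpha) (s * x))
  (fun j => - gamma_sin (j.+1%:R + alpha) (s * x))).
rewrite /frac_laplacian /pv_integral /clim /cintegral /= ReI ImI.
rewrite (cvg_lim _ pvr2)// (cvg_lim _ pvi2)//.
exact: (mulC_divK _ _ (lt0r_neq0 c0)).
Qed.

End RationalFunctions.

(** * Binomial expansion and the hypergeometric sum *)

Section HypergeometricForm.
Context {R : realType}.
Notation mu := (@lebesgue_measure R).
Implicit Types (v x alpha : R) (w : R[i]).

Lemma Gamma1 : Gamma 1 = 1 :> R.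
Proof.
have : (\int[mu]_(t in `]0%R, +oo[) (expR (- t))%:E = (0 - (-1))%:E)%E.
  apply: (@ge0_FTC2_gt0 R _ (fun t => - expR (- t))).
  - by move=> t _; exact: expR_ge0.
  - by move=> t _; notypeclasses refine (is_derive_continuous _); derivef.
  - by move=> t _; derive_eq; [derivef|rewrite /=; ring].
  - by rewrite -oppr0; apply: cvgN; exact: cvgr_expR.
  - rewrite -[X in - X](@expR0 R) -[X in expR X]oppr0; apply: cvgN; apply: cvg_at_right_filter.
    by apply: continuous_comp; [exact: continuousN|exact: continuous_expR].
rewrite sub0r opprK => h; rewrite /Gamma /Rintegral -[RHS]/(fine 1%:E) -h.
by congr fine; apply: eq_integral => t _; rewrite subrr powRr0 mul1r.
Qed.

Lemma Gamma_natr (k : nat) : Gamma k.+1%:R = k`!%:R :> R.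
Proof.
elim: k => [|k IH]; first exact: Gamma1.
by rewrite -natr1 GammaS ?ltr0Sn// IH factS natrM.
Qed.

Lemma Gamma_pochhammer alpha k : 0 < alpha ->
  (Gamma (alpha + k%:R))%:C = pochhammer alpha%:C k * (Gamma alpha)%:C.
Proof.
move=> a0; elim: k => [|k IH]; first by rewrite addr0 /pochhammer big_ord0 mul1r.
have ak : 0 < alpha + k%:R by rewrite ltr_wpDr.
rewrite -natr1 addrA GammaS// rmorphM/= IH /pochhammer big_ord_recr/= rmorphD/= rmorph_nat.
by rewrite mulrA [_ * \prod_(_ < _) _]mulrC.
Qed.

Lemma pochhammer2 k : pochhammer (2 : R[i]) k = k.+1`!%:R.
Proof.
elim: k => [|k IH]; first by rewrite /pochhammer big_ord0.
rewrite /pochhammer big_ord_recr/= -/(pochhammer 2 k) IH [in RHS]factS mulnC natrM.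
by congr (_ * _); rewrite -natrD.
Qed.

Lemma pochhammerN (M k : nat) : (k <= M)%N ->
  pochhammer (- M%:R : R[i]) k = (-1) ^+ k * (k`! * 'C(M, k))%:R.
Proof.
elim: k => [|k IH] kM; first by rewrite /pochhammer big_ord0 bin0 expr0 !mul1r.
rewrite /pochhammer big_ord_recr/= -/(pochhammer _ k) IH; last exact: ltnW.
rewrite ![(_`! * _)%N]mulnC !bin_ffact ffactnSr natrM natrB; last exact: ltnW.
by rewrite exprS; ring.
Qed.

(** The binomial coefficient of (1 + iv)^-(j+1) in (1 - 2/(1 + iv))^N, divided by Gamma(j+1) = j!
    because that power is replaced by its Gamma integral. The shift by one sets the constant term 1
    apart. *)
Definition lambda_coef (N j : nat) : R := 'C(N, j.+1)%:R * (-2) ^+ j.+1 / j`!%:R.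

Lemma expand_lambda N v : (1 - 2 / (1 +i* v)) ^+ N =
  1 + \sum_(j < N) (lambda_coef N j)%:C * (gamma_cos j.+1%:R v +i* - gamma_sin j.+1%:R v).
Proof.
rewrite exprDn big_ord_recl/= subn0 expr1n expr0 mul1r bin0 mulr1n; congr (_ + _).
apply: eq_bigr => j _; rewrite /bump/= add1n expr1n mul1r.
rewrite gamma_cpow_1Di ?ltr0Sn// Gamma_natr cpow_1Di_natr /lambda_coef.
rewrite -mulNr expr_div_n !rmorphM/= fmorphV !rmorph_nat rmorphXn/= rmorphN rmorph_nat.
have f0 : (j`!%:R : R[i]) != 0 by rewrite pnatr_eq0 -lt0n fact_gt0.
by rewrite mulrA divfK// -[LHS]mulr_natl mulrA.
Qed.

(** The two sums agree term by term: with N = M + 1, C(N, j+1) = N C(M, j) / (j+1), (-M)_j = (-1)^j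
    j! C(M, j), (2)_j = (j+1)!, and Gamma(1 + alpha + j) = (1 + alpha)_j Gamma(1 + alpha). The
    factor -2N comes from the lowest term j = 0. *)
Lemma hypergeometric_sum M alpha v : 0 < alpha ->
  \sum_(j < M.+1) (lambda_coef M.+1 j)%:C *
    (gamma_cos (j.+1%:R + alpha) v +i* - gamma_sin (j.+1%:R + alpha) v) =
  - (2 * M.+1%:R * (Gamma (1 + alpha))%:C / cpow (1 +i* v) (1 + alpha)%:C) *
    hyp2F1 (1 - M.+1%:R) (1 + alpha)%:C 2 (2 / (1 +i* v)).
Proof.
move=> a0; have a1 : 0 < 1 + alpha by rewrite addr_gt0.
rewrite (_ : 1 - M.+1%:R = - M%:R); last by rewrite -natr1; ring.
rewrite hyp2F1_finite mulr_sumr; apply: eq_bigr => j _.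
have jM : (j <= M)%N by rewrite -ltnS.
have -> : j.+1%:R + alpha = 1 + alpha + j%:R by rewrite -natr1; ring.
rewrite gamma_cpow_1Di; last by rewrite ltr_wpDr.
rewrite Gamma_pochhammer// cpow_1Di_addn /hyp2F1_term pochhammerN// pochhammer2 /lambda_coef.
set w := 1 +i* v; set c := cpow _ _; set P := pochhammer _ _; set G := (Gamma _)%:C.
have w0 : w != 0 by rewrite eq_complex /= oner_eq0.
(* As the inverse of 0 is 0 here, c = 0 would make both [gamma_cos] and [gamma_sin] vanish at v,
   hence the cosine and the sine of one angle. *)
have c0 : c != 0.
  apply/eqP => c0; have := gamma_cpow_1Di v a1; rewrite -/c c0 invr0 mulr0 => /eqP.
  have [-> ->] := gamma_cos_sinE v a1; rewrite eq_complex /= => /andP[/eqP h1 /eqP h2].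
  have := cos2Dsin2 ((1 + alpha) * atan v).
  have k0 : Gamma (1 + alpha) * (1 + v ^+ 2) `^ (- ((1 + alpha) / 2)) != 0.
    by rewrite gt_eqF// mulr_gt0 ?Gamma_gt0// powR_gt0// oneDsqr_gt0.
  move/eqP: h1; rewrite mulf_eq0 (negbTE k0)/= => /eqP ->.
  move/eqP: h2; rewrite oppr_eq0 mulf_eq0 (negbTE k0)/= => /eqP ->.
  by rewrite expr0n addr0 => /eqP; rewrite eq_sym oner_eq0.
have f0 : (j`!%:R : R[i]) != 0 by rewrite pnatr_eq0 -lt0n fact_gt0.
have j0 : (j.+1%:R : R[i]) != 0 by rewrite pnatr_eq0.
have bE : 'C(M.+1, j.+1)%:R = M.+1%:R * 'C(M, j)%:R / j.+1%:R :> R[i].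
  apply: (mulIf j0); rewrite divfK// -!natrM; congr (_%:R).
  by rewrite mulnC -mul_bin_diag.
rewrite !rmorphM/= fmorphV !rmorph_nat rmorphXn/= rmorphN rmorph_nat bE.
rewrite factS !natrM expr_div_n -[- 2]mulN1r exprMn !exprS.
have wj : w ^+ j != 0 by rewrite expf_neq0.
move: (w ^+ j) wj ((-1) ^+ j) (2 ^+ j) (j`!%:R) f0 (j.+1%:R) j0 => W W0 e t F F0 J J0.
move: ('C(M, j)%:R) (M.+1%:R) c c0 G P => C N c c0 G P.
field.
by rewrite W0 J0 F0 c0.
Qed.

(** The base is 1 - 2/(1 + ix) and its inverse is 1 - 2/(1 - ix), so a negative exponent amounts to
    replacing x by -x. *)
Lemma lambda_1Di (n : int) x :
  lambda n x = (1 - 2 / (1 +i* ((sgz n)%:~R * x))) ^+ `|n|%N.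
Proof.
have iE : 'i%C * x%:C = 0 +i* x by apply/eqP; rewrite eq_complex /= !mul0r !mul1r subr0 add0r !eqxx.
have wE (y : R) : 1 +i* y = 1 + (0 +i* y).
  by apply/eqP; rewrite eq_complex /= addr0 add0r !eqxx.
have w0 (y : R) : 1 + (0 +i* y) != 0 :> R[i] by rewrite -wE eq_complex /= oner_eq0.
have Ny : 0 +i* - x = - (0 +i* x) :> R[i] by apply/eqP; rewrite eq_complex /= oppr0 !eqxx.
have q1 y : 0 +i* y + 1 != 0 :> R[i] by rewrite addrC.
rewrite /lambda iE; case: n => [[|k]|k].
- by rewrite expr0z expr0.
- rewrite gtr0_sgz// mul1r wE -exprnP absz_nat; congr (_ ^+ _).
  by move: (0 +i* x) (q1 x) (w0 x) => q h1 h2; field; exact: h2.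
- rewrite NegzE -exprnN abszN absz_nat ltr0_sgz// mulrN1z mulN1r wE Ny -exprVn; congr (_ ^+ _).
  have := w0 (- x); have := q1 (- x); rewrite Ny invf_div.
  move: (0 +i* x) => q h1 h2.
  have h3 : q - 1 != 0 by rewrite -oppr_eq0 opprB.
  by field; rewrite h2 h3.
Qed.

End HypergeometricForm.

Theorem theorem2p1 (R : realType) (alpha : R) (n : int) (x : R)
    (alpha_gt0 : 0 < alpha) (alpha_lt2 : alpha < 2) :
  frac_laplacian_defined alpha (lambda n) x /\
  frac_laplacian alpha (lambda n) x =
    if n == 0 then 0
    else
      - (2 * (`|n|%N)%:R * (Gamma (1 + alpha))%:C /
         cpow ('i%C * (sgz n)%:~R * x%:C + 1) (1 + alpha)%:C) *
      hyp2F1 (1 - (`|n|%N)%:R) (1 + alpha)%:C 2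
             (2 / ('i%C * (sgz n)%:~R * x%:C + 1)).
Proof.
have [->|n0] := eqVneq n 0.
  (* [sgz 0 = 0], so the sign has to be chosen by hand *)
  have LE z : lambda 0 z = 1 + \sum_(j < 0) (lambda_coef 0 j)%:C *
      (gamma_cos j.+1%:R (1 * z) +i* - gamma_sin j.+1%:R (1 * z)) :> R[i].
    by rewrite big_ord0 addr0 /lambda expr0z.
  have [defd ->] := frac_laplacian_Fourier x (or_introl erefl) alpha_gt0 alpha_lt2 LE.
  by split; [exact: defd|rewrite big_ord0].
have s1 : ((sgz n)%:~R : R) = 1 \/ ((sgz n)%:~R : R) = -1.
  by case: sgzP n0 => // _ _; [left|right].
(* Writing |n| = M + 1 makes the first hypergeometric parameter 1 - |n| = -M, the terminating
   case. *)
have [M nM] : exists M, `|n|%N = M.+1.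
  by exists `|n|.-1; rewrite prednK// absz_gt0.
have LE z : lambda n z = 1 + \sum_(j < M.+1) (lambda_coef M.+1 j)%:C *
    (gamma_cos j.+1%:R ((sgz n)%:~R * z) +i* - gamma_sin j.+1%:R ((sgz n)%:~R * z)) :> R[i].
  by rewrite lambda_1Di nM expand_lambda.
have [defd ->] := frac_laplacian_Fourier x s1 alpha_gt0 alpha_lt2 LE.
split; first exact: defd.
have -> : 'i%C * (sgz n)%:~R * x%:C + 1 = 1 +i* ((sgz n)%:~R * x) :> R[i].
  rewrite -(rmorph_int (real_complex R)).
  apply/eqP; rewrite eq_complex /= !mul0r !mul1r !mulr0 !subr0 !add0r ?addr0 ?oppr0.
  by rewrite ?mul0r ?add0r ?addr0 !eqxx.
rewrite nM; exact: (hypergeometric_sum M _ alpha_gt0).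
Qed.
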